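(* Let $(\eta_s)_{s\ge 0}$ be a right process with state space $X$, infinite life time and invariant state $\nu$, and let $(G_\alpha)_{\alpha>0}$ be the strongly continuous contraction resolvent on $L^2(\ell\otimes\nu)$ associated with the space-time process $(s,\eta_s)_{s\ge 0}$. Fix $\beta>0$, let $T>0$ be a finite time horizon and let $c>0$. Then $$\int_0^T dt\,\mathbf{E}_\nu\Big[\int_0^{t}V(s,\eta_{cs})\,ds\Big]^2\,\le\,\frac{2e^{\beta T}}{\beta c^2}\,\big(\tilde V\,\big|\,G_{\frac{\beta}{2c}}\tilde V\big)_{L^2(\ell\otimes\nu)}$$ for all bounded functions $V$ in $L^2(\ell\otimes\nu)$, where $\tilde V(s,\eta)=e^{-\frac{\beta s}{2c}}\,V(s/c,\eta)$.
   Context: $X$ is a Hausdorff topological space whose Borel $\sigma$-algebra equals the $\sigma$-algebra generated by the set of all continuous functions on $X$. $(\Omega,\mathcal{F},\mathbf{P}_\eta,\eta\in X,(\eta_s)_{s\ge0})$ is a right process with state space $X$, infinite life time and filtration $(\mathcal{F}_s)_{s\ge 0}$ satisfying the usual conditions. $\nu$ is a probability measure on $X$ which is an invariant state of this process, and $\mathbf{E}_\nu$ is the expectation with respect to the probability measure $\int_X\mathbf{P}_\eta\,\nu(d\eta)$. $\ell$ is Lebesgue measure on $[0,\infty)$. The pair $(s,\eta_s)_{s\ge0}$ is a right process on $[0,\infty)\times X$. For bounded measurable $V$ on $[0,\infty)\times X$, its transition semigroup is $p_rV(s,\eta)=\mathbf{E}_{s,\eta}V(s+r,\eta_{s+r})$,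 $r\ge0$, where $\mathbf{E}_{s,\eta}$ is the expectation for the process started at time $s$ in state $\eta$ (equivalently, $p_rV(s,\eta)=\mathbf{E}_\eta V(s+r,\eta_r)$), and its resolvent is $R_\alpha V(s,\eta)=\int_0^\infty e^{-\alpha r}p_rV(s,\eta)\,dr$, $\alpha>0$. The measure $\ell\otimes\nu$ is excessive for $(p_r)_{r\ge 0}$, and consequently there is a strongly continuous contraction resolvent $(G_\alpha)_{\alpha>0}$ on $L^2(\ell\otimes\nu)$ such that $G_\alpha V$ is an $(\ell\otimes\nu)$-version of $R_\alpha V$ for all $\alpha>0$ and all bounded $V\in L^2(\ell\otimes\nu)$. $(\cdot\,|\,\cdot)_{L^2(\ell\otimes\nu)}$ is the inner product of $L^2(\ell\otimes\nu)$. *)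

(* Defs.v *)
From HB Require Import structures.
From mathcomp Require Import all_boot all_order all_algebra.
From mathcomp Require Import all_classical all_reals all_analysis.
From mathcomp Require Import measurable_realfun.

Set Implicit Arguments.
Unset Strict Implicit.
Unset Printing Implicit Defensive.
Import Order.TTheory GRing.Theory Num.Theory.
Import numFieldNormedType.Exports.

Local Open Scope classical_set_scope.
Local Open Scope ring_scope.

Notation borel X := (g_sigma_algebraType (@open X)).

Notation space_time R X := (measurableTypeR R * borel X)%type.

Definition borel_generated_by_continuous (R : realType)
    (X : ptopologicalType) : Prop :=
  <<s @open X >> =
  <<s [set A | exists2 f : X -> R, continuous f &
               exists2 B : set R, measurable B & A = f @^-1` B] >>.

(* [f] is measurable for the completion of the sigma-algebra of [E] with
   respect to every probability measure on [E]. *)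
Definition universally_measurable d (E : measurableType d) (R : realType)
    (f : E -> \bar R) : Prop :=
  forall mu : probability E R, exists g : E -> \bar R,
    measurable_fun setT g /\ f = g %[ae mu].

Record ukernel d1 d2 (E : measurableType d1) (Omega : measurableType d2)
    (R : realType) := UKernel {
  ukernel_fun :> E -> probability Omega R ;
  ukernel_measurable : forall A : set Omega, measurable A ->
    universally_measurable (fun x => ukernel_fun x A) }.

Section ge0_integral_ae.
Local Open Scope ereal_scope.
Context d (E : measurableType d) (R : realType).
Variable mu : {measure set E -> \bar R}.

Let ge0_le_integral_nomeas (f g : E -> \bar R) :
  (forall x, 0 <= f x) -> (forall x, f x <= g x) ->
  \int[mu]_x f x <= \int[mu]_x g x.
Proof.
move=> f0 fg; rewrite !ge0_integralTE; [|by move=> x; rewrite (le_trans (f0 x))|by []].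
apply: le_ereal_sup => _ [h hf <-]; exists h => // x.
exact: le_trans (hf x) (fg x).
Qed.

(* No measurability of [f]: the integral of a nonnegative function is the
   supremum over the simple functions below it, which is its integral for the
   completion of [mu] as soon as [f] is measurable for that completion. *)
Lemma ge0_integral_ae (f g : E -> \bar R) :
  (forall x, 0 <= f x) -> measurable_fun setT g -> f = g %[ae mu] ->
  \int[mu]_x f x = \int[mu]_x `|g x|.
Proof.
move=> f0 mg [N [mN N0 fgN]].
have fg x : ~ N x -> f x = `|g x|.
  move=> nNx; have gfx : g x = f x; last by rewrite gfx gee0_abs.
  apply: esym; apply: contrapT => fgx; apply: nNx; apply: fgN => H.
  exact: fgx (H Logic.I).
have mag : measurable_fun setT (abse \o g) by exact: measurableT_comp.
pose h c x := if x \in N then c else `|g x|.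
have mh c : measurable_fun setT (h c).
  apply: measurable_fun_ifT => //; apply: (measurable_fun_bool true).
  rewrite setTI (_ : _ @^-1` _ = N)//; apply/seteqP.
  by split=> x /=; [move/set_mem|move/mem_set].
have ih c : 0 <= c -> \int[mu]_x h c x = \int[mu]_x `|g x|.
  move=> c0; apply: ge0_ae_eq_integral => //.
  - by move=> x _; rewrite /h; case: ifPn.
  - exists N; split=> // x /= hx; apply: contrapT => nNx; apply: hx => _.
    by rewrite /h memNset.
apply/eqP; rewrite eq_le; apply/andP; split.
- rewrite -(ih +oo)//; apply: ge0_le_integral_nomeas => // x.
  by rewrite /h; case: ifPn => [_|/negP xN]; rewrite ?leey// fg// => /mem_set.
- rewrite -(ih 0)//; apply: ge0_le_integral_nomeas => x.
  + by rewrite /h; case: ifPn.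
  + by rewrite /h; case: ifPn => // /negP xN; rewrite fg// => /mem_set.
Qed.

End ge0_integral_ae.

Section mixture.
Local Open Scope ereal_scope.
Context d1 d2 (E : measurableType d1) (Omega : measurableType d2).
Context (R : realType) (P : ukernel E Omega R) (mu : probability E R).

Definition mixture (A : set Omega) : \bar R := \int[mu]_x P x A.

Let mixture0 : mixture set0 = 0.
Proof. by rewrite /mixture integral0_eq. Qed.

Let mixture_ge0 A : 0 <= mixture A.
Proof. exact: integral_ge0. Qed.

Let mixture_sigma_additive : semi_sigma_additive mixture.
Proof.
move=> F mF tF mUF.
have /choice[g /all_and2[mg Pg]] : forall n, exists g : E -> \bar R,
    measurable_fun setT g /\ (fun x => P x (F n)) = g %[ae mu].
  by move=> n; exact: ukernel_measurable.
have mag n : measurable_fun setT (abse \o g n) by exact: measurableT_comp.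
have PF n : mixture (F n) = \int[mu]_x `|g n x| by exact: ge0_integral_ae.
have -> : mixture (\bigcup_n F n) = \sum_(n <oo) mixture (F n).
  have negN := negligible_bigcup Pg.
  rewrite (eq_eseriesr (g := fun n => \int[mu]_x `|g n x|)); last by [].
  rewrite -integral_nneseries//.
  rewrite /mixture (@ge0_integral_ae _ _ _ mu (fun x => P x (\bigcup_n F n))
    (fun x => \sum_(n <oo) `|g n x|))//.
  - apply: eq_integral => x _; rewrite gee0_abs//.
    exact: nneseries_ge0.
  - have := @ge0_emeasurable_sum _ _ R setT (fun n x => `|g n x|) xpredT.
    by apply=> // *; exact: mag.
  - apply: negligibleS negN => x /= nx; apply: contrapT => nN; apply: nx => _.
    have gx n : P x (F n) = `|g n x|.
      have gx : P x (F n) = g n x; last by rewrite -gx gee0_abs.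
      apply: contrapT => h; apply: nN; exists n => // H.
      exact: h (H Logic.I).
    have /cvg_lim <-// := @measure_sigma_additive _ _ _ (P x) F mF tF.
    by apply/congr_lim/funext => n; apply: eq_bigr => i _; rewrite /= gx.
by apply/cvg_closeP; split; [apply: is_cvg_nneseries|rewrite closeE].
Qed.

HB.instance Definition _ := isMeasure.Build _ _ _ mixture
  mixture0 mixture_ge0 mixture_sigma_additive.

Let mixture_setT : mixture setT = 1.
Proof.
rewrite /mixture (eq_integral (cst 1)).
  by rewrite integral_cst// mul1e; exact: probability_setT.
by move=> x _; exact: probability_setT.
Qed.

HB.instance Definition _ :=
  Measure_isProbability.Build _ _ _ mixture mixture_setT.

End mixture.

Section right_process.
Context (R : realType) (X : ptopologicalType).
Context d (Omega : measurableType d).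
Implicit Types (P : ukernel (borel X) Omega R) (F : R -> set (set Omega)).
Implicit Types (eta : R -> Omega -> X) (sigma : Omega -> \bar R).

Definition filtration F : Prop :=
  [/\ forall s, 0 <= s -> sigma_algebra setT (F s),
      forall s, 0 <= s -> F s `<=` measurable &
      forall s t, 0 <= s -> s <= t -> F s `<=` F t].

Definition right_continuous_filtration F : Prop :=
  forall s, 0 <= s -> F s = \bigcap_(t in [set t | s < t]) F t.

(* [G] is the intersection over all initial laws [mu] of its augmentations by
   the negligible sets of [mixture P mu]. *)
Definition augmented P (G : set (set Omega)) : Prop :=
  forall A, (forall mu : probability (borel X) R, exists2 B, G B &
               (mixture P mu).-negligible ((A `\` B) `|` (B `\` A))) -> G A.

Definition usual_conditions P F : Prop :=
  [/\ right_continuous_filtration F,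
      augmented P measurable & forall s, 0 <= s -> augmented P (F s)].

Definition path_sigma_algebra eta : set (set Omega) :=
  <<s [set B | exists2 s : R, 0 <= s &
               exists2 A : set (borel X), measurable A & B = eta s @^-1` A] >>.

Definition cond_probability_version (Q : probability Omega R)
    (G : set (set Omega)) (B : set Omega) (f : Omega -> \bar R) : Prop :=
  (forall Y : set (\bar R), measurable Y -> G (f @^-1` Y)) /\
  (forall A, G A -> Q (B `&` A) = \int[Q]_(w in A) f w)%E.

Definition stopping_time F sigma : Prop :=
  (forall w, 0 <= sigma w)%E /\
  (forall s, 0 <= s -> F s [set w | (sigma w <= s%:E)%E]).

Definition stopped_sigma_algebra F sigma : set (set Omega) :=
  [set A | measurable A /\
           forall s, 0 <= s -> F s (A `&` [set w | (sigma w <= s%:E)%E])].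

(* The event that [sigma] is finite and [eta] is in [A] at time [sigma + t]. *)
Definition stopped_event eta sigma (t : R) (A : set X) : set Omega :=
  [set w | exists2 r : R, sigma w = r%:E & A (eta (r + t) w)].

Definition stopped_transition P eta sigma (t : R) (A : set X) (w : Omega) :
    \bar R :=
  if sigma w is r%:E then P (eta r w) (eta t @^-1` A) else 0%E.

(* Time is the half-line [0, +oo[: nothing is required of [F s] and [eta s]
   for [s < 0]. The life time being infinite, there is no cemetery state. *)
Record right_process P F eta : Prop := {
  rp_filtration : filtration F ;
  rp_usual : usual_conditions P F ;
  rp_adapted : forall s, 0 <= s ->
    forall A : set (borel X), measurable A -> F s (eta s @^-1` A) ;
  rp_shift : forall t, 0 <= t -> exists theta : Omega -> Omega,
    forall s w, 0 <= s -> eta s (theta w) = eta (s + t) w ;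
  rp_measurable : forall B, path_sigma_algebra eta B ->
    measurable_fun [set: borel X] (fun x => P x B) ;
  rp_markov : forall (x : X) (s t : R) (A : set (borel X)),
    0 <= s -> 0 <= t -> measurable A ->
    cond_probability_version (P x) (F s) (eta (s + t) @^-1` A)
      (fun w => P (eta s w) (eta t @^-1` A)) ;
  rp_normal : forall x : X, P x [set w | eta 0 w = x] = 1%E ;
  rp_right_continuous : forall (w : Omega) (t : R), 0 <= t ->
    eta s w @[s --> t^'+] --> eta t w ;
  rp_strong_markov : forall sigma (mu : probability (borel X) R) (t : R)
      (A : set (borel X)),
    stopping_time F sigma -> 0 <= t -> measurable A ->
    cond_probability_version (mixture P mu) (stopped_sigma_algebra F sigma)
      (stopped_event eta sigma t A) (stopped_transition P eta sigma t A) }.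

Definition invariant_state P eta (nu : probability (borel X) R) : Prop :=
  forall (t : R) (A : set (borel X)), 0 <= t -> measurable A ->
    mixture P nu (eta t @^-1` A) = nu A.

Definition space_time_semigroup P eta (r : R) (V : space_time R X -> R)
    (z : space_time R X) : R :=
  fine 'E_(P z.2)[(fun w => V ((z.1 : R) + r, eta r w))].

Definition space_time_resolvent P eta (alpha : R) (V : space_time R X -> R)
    (z : space_time R X) : R :=
  \int[lebesgue_measure]_(r in `[0, +oo[)
    (expR (- alpha * r) * space_time_semigroup P eta r V z).

End right_process.

(* Elements of L2 are given by representatives: [G alpha] acts on functions,
   compatibly with almost everywhere equality. *)
Record sc_contraction_resolvent d (E : measurableType d) (R : realType)
    (mu : {measure set E -> \bar R}) (G : R -> (E -> R) -> E -> R) : Prop := {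
  cr_Lfun : forall (a : R) f, 0 < a -> f \in Lfun mu 2%:E ->
    G a f \in Lfun mu 2%:E ;
  cr_ae_eq : forall (a : R) f g, 0 < a ->
    f \in Lfun mu 2%:E -> g \in Lfun mu 2%:E ->
    f = g %[ae mu] -> G a f = G a g %[ae mu] ;
  cr_linear : forall (a k : R) f g, 0 < a ->
    f \in Lfun mu 2%:E -> g \in Lfun mu 2%:E ->
    G a (fun x => k * f x + g x) = (fun x => k * G a f x + G a g x) %[ae mu] ;
  cr_resolvent : forall (a b : R) f, 0 < a -> 0 < b -> f \in Lfun mu 2%:E ->
    (fun x => G a f x - G b f x) = (fun x => (b - a) * G a (G b f) x)
    %[ae mu] ;
  cr_contraction : forall (a : R) f, 0 < a -> f \in Lfun mu 2%:E ->
    ('N[mu]_2%:E[(fun x => (a * G a f x)%:E)] <=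
     'N[mu]_2%:E[EFin \o f])%E ;
  cr_strongly_continuous : forall f, f \in Lfun mu 2%:E ->
    ('N[mu]_2%:E[(fun x => (a * G a f x - f x)%:E)] @[a --> +oo%R] --> 0)%E }.

Definition L2_inner d (E : measurableType d) (R : realType)
    (mu : {measure set E -> \bar R}) (f g : E -> R) : R :=
  \int[mu]_x (f x * g x).

Section space_time_L2.
Context (R : realType) (X : ptopologicalType) (nu : probability (borel X) R).

(* The space [0, +oo[ * X is rendered as R * X with a measure that does not
   charge negative times. *)
Definition lebesgue_halfline : set (measurableTypeR R) -> \bar R :=
  mrestr (@lebesgue_measure R) (measurable_itv `[0, +oo[).

HB.instance Definition _ := Measure.on lebesgue_halfline.

Definition space_time_measure : set (space_time R X) -> \bar R :=
  (lebesgue_halfline \x nu)%E.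

HB.instance Definition _ := Measure.on space_time_measure.

Definition bounded_space_time (V : space_time R X -> R) : Prop :=
  exists M : R, forall s x, 0 <= s -> `|V (s, x)| <= M.

Definition rescaled (beta c : R) (V : space_time R X -> R)
    (z : space_time R X) : R :=
  expR (- (beta * (z.1 : R) / (2 * c))) * V ((z.1 : R) / c, z.2).

End space_time_L2.

Definition space_time_L2_resolvent (R : realType) (X : ptopologicalType) d
    (Omega : measurableType d) (P : ukernel (borel X) Omega R)
    (eta : R -> Omega -> X) (nu : probability (borel X) R)
    (G : R -> (space_time R X -> R) -> space_time R X -> R) : Prop :=
  sc_contraction_resolvent (space_time_measure nu) G /\
  forall (alpha : R) (V : space_time R X -> R), 0 < alpha ->
    V \in Lfun (space_time_measure nu) 2%:E -> bounded_space_time V ->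
    G alpha V = space_time_resolvent P eta alpha V
      %[ae space_time_measure nu].

(* Main.v *)
Require Import Defs.
From HB Require Import structures.
From mathcomp Require Import all_boot all_order all_algebra.
From mathcomp Require Import all_classical all_reals all_analysis.
From mathcomp Require Import measurable_realfun ring lra.
Import Order.TTheory GRing.Theory Num.Theory.
Import numFieldNormedType.Exports.

(** Up to the factor exp (beta T), the inequality is an identity for a Laplace
transform. Let Y t be the integral of V (s, eta (c s)) over s in [0, t], and
alpha = beta / (2 c). Since exp (beta T) exp (- beta t) >= 1 for t <= T, the
left-hand side is at most exp (beta T) times the integral over t >= 0 of
exp (- beta t) E[(Y t)^2] ([integral_second_moment_le]), and that integral is
computed exactly ([laplace_second_moment]).

Path by path, with h s = V (s, eta (c s)), the square (Y t)^2 is the integral of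
h s * h r over 0 <= s, r <= t. Integrating in t first leaves the weight
exp (- beta max (s, r)) / beta on the quadrant ([laplace_sqr_primitive]). By
symmetry the quadrant counts twice the triangle s <= r. Replacing s by s / c and
r by (s + u) / c turns the weight exp (- beta r) into
exp (- beta (s + u) / c) = exp (- alpha u) exp (- alpha s) exp (- alpha (s + u)):
the first factor is the discount of the resolvent of parameter alpha, the other
two go with the two occurrences of V and turn V into its rescaled version W
([integral_max_triangle]).

It remains to take expectations. The Markov property and the invariance of nu
identify E[W (s, eta s) W (s + u, eta (s + u))] with the integral of
W (s, x) E_x[W (s + u, eta u)] against nu (dx) ([two_time_expectation]);
integrating over s and u with weight exp (- alpha u) gives the inner product of
W with its resolvent ([resolvent_form]).

Because V is bounded, every exchange of integrals of a signed function concerns an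
integrand dominated by a product of integrable functions of separate variables
([dominated_integrable_prod]). The exchanges also require that eta s w be jointly
measurable in (s, w); this is where the right continuity of the paths and the
generation of the Borel sets by continuous functions enter
([measurable_halted_path]). *)

Set Implicit Arguments.
Unset Strict Implicit.
Unset Printing Implicit Defensive.
Local Open Scope classical_set_scope.
Local Open Scope ring_scope.

(** * Integration on the line and on products *)

Lemma pos_muleBr (R : realType) (c : R) (x y : \bar R) : 0 < c ->
  (c%:E * (x - y) = c%:E * x - c%:E * y)%E.
Proof.
move=> c0; have c0E : (0 < c%:E)%E by rewrite lte_fin.
case: y => [y| |]; first by rewrite muleBr// fin_num_adde_defl.
  by rewrite gt0_muley//= !addeNy gt0_muleNy.
rewrite gt0_muleNy//=; case: x => [x| |].
- by rewrite addey// gt0_muley.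
- by rewrite addey// gt0_muley// addey.
- by rewrite addNye gt0_muleNy.
Qed.

Section affine_change_of_variables.
Context (R : realType).
Notation lambda := (@lebesgue_measure R).
Variables (c a : R) (c_gt0 : 0 < c).

Let aff (x : measurableTypeR R) : measurableTypeR R := c * x + a.

Let measurable_aff : measurable_fun setT aff.
Proof. by apply: measurable_funD => //; apply: measurable_funM. Qed.

Let image_measure : {measure set (measurableTypeR R) -> \bar R}.
Proof. by refine (pushforward lambda aff : {measure set _ -> \bar R}). Defined.

(* Both sides are measures, so it is enough to compare them on the half-open
   intervals, whose preimages are again half-open intervals. *)
Let affine_lebesgue (A : set (measurableTypeR R)) : measurable A ->
  lambda A = mscale (NngNum (ltW c_gt0)) image_measure A.
Proof.
apply: lebesgue_measure_unique => _ [[p q]] _ <-.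
rewrite /= /mscale /image_measure /= /pushforward.
rewrite (_ : aff @^-1` _ = `](p - a) / c, (q - a) / c]%classic); last first.
  apply/seteqP; split=> x /=; rewrite !in_itv/= /aff.
    move=> /andP[? ?]; rewrite ltr_pdivrMr// ler_pdivlMr//.
    by apply/andP; split; lra.
  by rewrite ltr_pdivrMr// ler_pdivlMr// => /andP[? ?]; apply/andP; split; lra.
rewrite !lebesgue_measure_itv/= !lte_fin ltr_pM2r ?invr_gt0// ltrD2r.
case: ifPn => _; last by rewrite mule0.
by rewrite -!EFinB -EFinM; congr _%:E; field; rewrite gt_eqF.
Qed.

Local Open Scope ereal_scope.

Let ge0_integral_affine (f : measurableTypeR R -> \bar R) :
  measurable_fun setT f -> (forall x, 0 <= f x) ->
  \int[lambda]_x f x = c%:E * \int[lambda]_x f (c * x + a)%R.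
Proof.
move=> mf f0.
rewrite (eq_measure_integral _ (fun A mA _ => affine_lebesgue mA)).
by rewrite ge0_integral_mscale//= ge0_integral_pushforward.
Qed.

(** The positive and negative parts are substituted separately; a positive real
distributes over the difference of their integrals even when both are
infinite. *)
Lemma integral_affine (f : measurableTypeR R -> \bar R) :
  measurable_fun setT f ->
  \int[lambda]_x f x = c%:E * \int[lambda]_x f (c * x + a)%R.
Proof.
move=> mf; rewrite [LHS]integralE [in RHS]integralE.
rewrite (ge0_integral_affine (measurable_funepos mf))//.
rewrite (ge0_integral_affine (measurable_funeneg mf))//.
set F := fun x => f (c * x + a)%R.
have -> : \int[lambda]_x f^\+ (c * x + a)%R = \int[lambda]_x F^\+ x.
  by apply: eq_integral => x _; rewrite !funeposE.
have -> : \int[lambda]_x f^\- (c * x + a)%R = \int[lambda]_x F^\- x.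
  by apply: eq_integral => x _; rewrite !funenegE.
exact: esym (pos_muleBr _ _ c_gt0).
Qed.

End affine_change_of_variables.

Section tensor.
Context d1 d2 (T1 : measurableType d1) (T2 : measurableType d2) (R : realType).
Variables (m1 : {sigma_finite_measure set T1 -> \bar R})
          (m2 : {sigma_finite_measure set T2 -> \bar R}).
Local Open Scope ereal_scope.

Lemma integrable_tensor (f : T1 -> R) (g : T2 -> R) :
  m1.-integrable setT (EFin \o f) -> m2.-integrable setT (EFin \o g) ->
  (m1 \x m2).-integrable setT (fun z => (f z.1 * g z.2)%:E).
Proof.
move=> /integrableP[mf foo] /integrableP[mg goo].
have mfg : measurable_fun setT (fun z : T1 * T2 => (f z.1 * g z.2)%:E).
  apply/measurable_EFinP/measurable_funM.
    by apply: measurableT_comp => //; exact/measurable_EFinP.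
  by apply: measurableT_comp => //; exact/measurable_EFinP.
apply/integrable12ltyP => //=.
under eq_integral.
  move=> x _.
  under eq_integral do rewrite normrM EFinM.
  rewrite ge0_integralZl//; last first.
    by apply/measurable_EFinP/measurableT_comp => //; exact/measurable_EFinP.
  over.
rewrite ge0_integralZr//.
- rewrite lte_mul_pinfty//; first exact: integral_ge0.
  by rewrite ge0_fin_numE//; exact: integral_ge0.
- by apply/measurable_EFinP/measurableT_comp => //; exact/measurable_EFinP.
- exact: integral_ge0.
Qed.

(** All uses of Fubini's theorem for signed functions below go through this
criterion, with exponentials or constants as [f] and [g]. *)
Lemma dominated_integrable_prod (h : T1 * T2 -> R) (f : T1 -> R) (g : T2 -> R) :
  measurable_fun setT h ->
  m1.-integrable setT (EFin \o f) -> m2.-integrable setT (EFin \o g) ->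
  (forall x y, `|h (x, y)| <= f x * g y)%R ->
  (m1 \x m2).-integrable setT (EFin \o h).
Proof.
move=> mh intf intg hfg.
apply: le_integrable (integrable_tensor intf intg) => //.
  exact/measurable_EFinP.
by move=> [x y] _ /=; rewrite lee_fin (le_trans (hfg x y))// ler_norm.
Qed.

End tensor.

Lemma Rintegral_mul_tensor d1 d2 (T1 : measurableType d1)
    (T2 : measurableType d2) (R : realType)
    (m1 : {sigma_finite_measure set T1 -> \bar R})
    (m2 : {sigma_finite_measure set T2 -> \bar R}) (f : T1 -> R) (g : T2 -> R) :
  m1.-integrable setT (EFin \o f) -> m2.-integrable setT (EFin \o g) ->
  ((\int[m1]_x f x * \int[m2]_y g y)%R%:E =
   \int[m1 \x m2]_z (f z.1 * g z.2)%:E)%E.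
Proof.
move=> intf intg; rewrite -integral12_prod_meas1; last exact: integrable_tensor.
rewrite EFinM /fubini_F /Rintegral fineK; last exact: integrable_fin_num.
under [RHS]eq_integral.
  move=> x _; rewrite /=; under eq_integral do rewrite EFinM.
  rewrite integralZl// -[X in (_ * X)%E]fineK; last exact: integrable_fin_num.
  over.
by rewrite integralZr.
Qed.

Lemma integrable_fubini_G d1 d2 (T1 : measurableType d1)
    (T2 : measurableType d2) (R : realType)
    (m1 : {sigma_finite_measure set T1 -> \bar R})
    (m2 : {sigma_finite_measure set T2 -> \bar R}) (f : T1 * T2 -> \bar R) :
  (m1 \x m2)%E.-integrable setT f ->
  m2.-integrable setT (fun y => \int[m1]_x f (x, y))%E.
Proof.
move=> intf; have mf := measurable_int _ intf.
have maf : measurable_fun setT (abse \o f) by exact: measurableT_comp.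
have mG : measurable_fun setT (fun y => \int[m1]_x f (x, y))%E.
  exact: measurable_fubini_G intf.
apply/integrableP; split => //.
apply: le_lt_trans ((integrable21ltyP m1 m2 mf).1 intf).
apply: ge0_le_integral => //.
- exact: measurableT_comp.
- exact: (measurable_fun_fubini_tonelli_G (m1 := m1) (abse \o f) maf (fun=> abse_ge0 _)).
- move=> y _; apply: le_abse_integral => //.
  by apply: (measurableT_comp mf); exact: pair2_measurable.
Qed.

Lemma measurable_integral_section d1 d2 (T1 : measurableType d1)
    (T2 : measurableType d2) (R : realType)
    (m2 : {sigma_finite_measure set T2 -> \bar R}) (f : T1 * T2 -> R) :
  measurable_fun setT f ->
  measurable_fun setT (fun x => \int[m2]_y (f (x, y))%:E)%E.
Proof.
move=> mf; have mEf : measurable_fun setT (EFin \o f) by exact/measurable_EFinP.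
under eq_fun do rewrite integralE.
apply: emeasurable_funB.
- have := measurable_fun_fubini_tonelli_F (m2 := m2) _ (measurable_funepos mEf)
    (fun=> funepos_ge0 _ _).
  congr (measurable_fun _ _); apply/funext => x.
  by apply: eq_integral => y _; rewrite !funeposE.
- have := measurable_fun_fubini_tonelli_F (m2 := m2) _ (measurable_funeneg mEf)
    (fun=> funeneg_ge0 _ _).
  congr (measurable_fun _ _); apply/funext => x.
  by apply: eq_integral => y _; rewrite !funenegE.
Qed.

Lemma measurable_Rintegral_section d1 d2 (T1 : measurableType d1)
    (T2 : measurableType d2) (R : realType)
    (m2 : {sigma_finite_measure set T2 -> \bar R}) (f : T1 * T2 -> R) :
  measurable_fun setT f ->
  measurable_fun setT (fun x => \int[m2]_y f (x, y)).
Proof.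
move=> mf; apply: (measurableT_comp (fine_measurable measurableT)).
exact: measurable_integral_section.
Qed.

Section lebesgue_plane.
Context (R : realType).
Notation lambda := (@lebesgue_measure R).
Notation mR := (measurableTypeR R).

(** The product measure under a name of its own, which can carry the
sigma-finite structure that makes the plane a factor of further products. *)
Definition lebesgue_plane : set (mR * mR) -> \bar R := (lambda \x lambda)%E.

HB.instance Definition _ := Measure.on lebesgue_plane.

Let lebesgue_plane_sigma_finite : sigma_finite setT lebesgue_plane.
Proof.
pose I n : set mR := `](- n%:R)%R, n%:R]%classic.
exists (fun n => I n `*` I n).
  apply/seteqP; split=> // -[x y] _.
  have Ix z m : (`|z| < m%:R)%R -> I m z.
    by rewrite ltr_norml => /andP[? ?]; rewrite /I/= in_itv/=; apply/andP; split; lra.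
  have /= xy := archi_boundP (normr_ge0 (Num.max `|x| `|y|)).
  rewrite ger0_norm ?le_max ?normr_ge0// gt_max in xy; move/andP: xy => [hx hy].
  by eexists => //; split; apply: Ix; [exact: hx|exact: hy].
have mI n : measurable (I n) by exact: measurable_itv.
move=> n; split; first exact: measurableX.
have In : (lambda (I n) < +oo)%E.
  by rewrite lebesgue_measure_itv; case: ifP => _; rewrite ltry.
rewrite /= /lebesgue_plane product_measure1E//; apply: lte_mul_pinfty => //.
by rewrite ge0_fin_numE.
Qed.

HB.instance Definition _ := Measure_isSigmaFinite.Build _ _ _
  lebesgue_plane lebesgue_plane_sigma_finite.

End lebesgue_plane.

(** * Exponential discounting *)

Lemma measurable_natr_bool d (T : measurableType d) (R : realType)
    (b : T -> bool) :
  measurable_fun setT b -> measurable_fun setT (fun x => (b x)%:R : R).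
Proof.
move=> mb; rewrite (_ : (fun _ => _) = fun x => if b x then 1 else 0).
  exact: measurable_fun_ifT.
by apply/funext => x; case: (b x).
Qed.

Section discount.
Context (R : realType).
Notation lambda := (@lebesgue_measure R).

(** The indicator of the half-line is part of the weight, so that integrals over
positive times become integrals over the whole line, where Lebesgue measure is
invariant under translation. *)
Definition discount (a s : R) : R := (0 <= s)%R%:R * expR (- (a * s)).

Lemma discount_ge0 (a s : R) : 0 <= discount a s.
Proof. by rewrite /discount mulr_ge0// ?ler0n// expR_ge0. Qed.

Lemma discount_le1 (a s : R) : 0 <= a -> discount a s <= 1.
Proof.
move=> a0; rewrite /discount; case: (leP 0 s) => s0; last by rewrite mulr0n mul0r ler01.
by rewrite mulr1n mul1r -expR0 ler_expR oppr_le0 mulr_ge0.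
Qed.

Lemma lt0_discount (a s : R) : s < 0 -> discount a s = 0.
Proof. by move=> s0; rewrite /discount leNgt s0 mul0r. Qed.

Lemma measurable_discount (a : R) :
  measurable_fun setT (discount a : measurableTypeR R -> R).
Proof.
apply: measurable_funM.
  by apply: measurable_natr_bool; apply: measurable_fun_ler.
by apply: measurableT_comp => //; apply: measurableT_comp => //;
  apply: measurable_funM.
Qed.

Lemma integral_discount (a : R) : 0 < a ->
  (\int[lambda]_s (discount a s)%:E = a^-1%:E)%E.
Proof.
move=> a0; have aE s : discount a s = a^-1 * exponential_pdf a s.
  rewrite /discount; case: (leP 0 s) => s0 /=; last first.
    by rewrite lt0_exponential_pdf// mulr0 mulr0n mul0r.
  by rewrite exponential_pdfE// mulr1n mul1r mulKf ?gt_eqF// mulNr.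
under eq_integral do rewrite aE EFinM.
rewrite ge0_integralZl//; first by rewrite integral_exponential_pdf// mule1.
- by apply/measurable_EFinP; exact: measurable_exponential_pdf.
- by move=> s _; rewrite lee_fin exponential_pdf_ge0// ltW.
- by rewrite lee_fin invr_ge0 ltW.
Qed.

Lemma integrable_discount (a : R) : 0 < a ->
  lambda.-integrable setT (EFin \o discount a).
Proof.
move=> a0; apply/integrableP; split.
  by apply/measurable_EFinP; exact: measurable_discount.
under eq_integral do rewrite /= ger0_norm ?discount_ge0//.
by rewrite integral_discount// ltry.
Qed.

Lemma integral_discount_tail (a m : R) : 0 < a ->
  (\int[lambda]_t ((m <= t)%R%:R * expR (- (a * t)))%:E =
   (a^-1 * expR (- (a * m)))%:E)%E.
Proof.
move=> a0; rewrite (integral_affine m ltr01) ?mul1e; last first.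
  apply/measurable_EFinP/measurable_funM.
    by apply: measurable_natr_bool; apply: measurable_fun_ler.
  by apply: measurableT_comp => //; apply: measurableT_comp => //;
    apply: measurable_funM.
under eq_integral.
  move=> t _; rewrite mul1r (_ : _ * _ = expR (- (a * m)) * discount a t).
    rewrite EFinM; over.
  rewrite /discount lerDr mulrCA -expRD; congr (_ * expR _); ring.
rewrite ge0_integralZl ?integral_discount//.
- by rewrite -EFinM mulrC.
- by apply/measurable_EFinP; exact: measurable_discount.
- by move=> s _; rewrite lee_fin discount_ge0.
Qed.

End discount.

(** * Laplace transform of the square of a primitive *)

Section squared_primitive.
Context (R : realType).
Notation lambda := (@lebesgue_measure R).
Notation plane := (@lebesgue_plane R).
Variables (h : measurableTypeR R -> R) (M : R).
Hypotheses (mh : measurable_fun setT h) (hM : forall s, `|h s| <= M)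
  (h0 : forall s : R, s < 0 -> h s = 0).

Let M_ge0 : 0 <= M. Proof. exact: le_trans (hM 0). Qed.

Let mleC t : measurable_fun setT (fun s : measurableTypeR R => (s <= t)%R%:R : R).
Proof. by apply: measurable_natr_bool; exact: measurable_fun_ler. Qed.

Let integrable_stopped t :
  lambda.-integrable setT (EFin \o (fun s => (s <= t)%R%:R * h s)).
Proof.
(* On [0, t] the constant M is at most M * exp t * exp (- s). *)
have := integrableZl measurableT (M * expR t) (integrable_discount ltr01).
apply: le_integrable => //.
  by apply/measurable_EFinP/measurable_funM.
move=> s _ /=; rewrite lee_fin normrM normr_nat.
rewrite (ger0_norm (mulr_ge0 (mulr_ge0 M_ge0 (expR_ge0 _)) (discount_ge0 _ _))).
have [s0|s0] := ltP s 0.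
  by rewrite h0// normr0 mulr0 !mulr_ge0// ?expR_ge0 ?discount_ge0.
rewrite /discount s0 mulr1n !mul1r -mulrA -expRD.
have [st|st] := leP s t; last by rewrite mulr0n mul0r mulr_ge0// expR_ge0.
rewrite mulr1n mul1r (le_trans (hM s))// ler_peMr// -expR0 ler_expR; lra.
Qed.

Variables (beta : R) (beta_gt0 : 0 < beta).

Let b3_gt0 : 0 < beta / 3. Proof. by rewrite divr_gt0. Qed.

(** The square is a double integral over s, r <= t, and integrating first in t
leaves exp (- beta t) integrated over t >= max (s, r). *)
Lemma laplace_sqr_primitive :
  (\int[lambda]_t
     (discount beta t * (\int[lambda]_s ((s <= t)%R%:R * h s)) ^+ 2)%:E =
   \int[plane]_z
     (beta^-1 * (h z.1 * h z.2 * expR (- (beta * Num.max z.1 z.2))))%:E)%E.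
Proof.
pose T3 := (measurableTypeR R * (measurableTypeR R * measurableTypeR R))%type.
pose Phi (y : T3) : R := discount beta y.1 *
  (((y.2.1 <= y.1)%R%:R * h y.2.1) * ((y.2.2 <= y.1)%R%:R * h y.2.2)).
have mPhi : measurable_fun setT Phi.
  have m1 : measurable_fun setT (fun y : T3 => y.2.1).
    exact: measurableT_comp.
  have m2 : measurable_fun setT (fun y : T3 => y.2.2).
    exact: measurableT_comp.
  apply: measurable_funM; first exact: measurableT_comp (@measurable_discount _ _) _.
  apply: measurable_funM; apply: measurable_funM.
  - by apply: measurable_natr_bool; exact: measurable_fun_ler.
  - exact: measurableT_comp.
  - by apply: measurable_natr_bool; exact: measurable_fun_ler.
  - exact: measurableT_comp.
(* For s, r <= t, exp (- beta t) <= exp (- (beta / 3) (t + s + r)). *)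
have intPhi : (lambda \x plane)%E.-integrable setT (EFin \o Phi).
  have I1 := integrable_discount b3_gt0.
  have I2 : plane.-integrable setT (EFin \o
      (fun z => M ^+ 2 * (discount (beta / 3) z.1 * discount (beta / 3) z.2))).
    have := integrableZl measurableT (M ^+ 2) (integrable_tensor I1 I1).
    by apply: eq_integrable.
  apply: (dominated_integrable_prod (m2 := plane) mPhi I1 I2) => t [s r].
  rewrite /Phi/=.
  have rhs_ge0 : 0 <= discount (beta / 3) t *
      (M ^+ 2 * (discount (beta / 3) s * discount (beta / 3) r)).
    by rewrite !mulr_ge0 ?discount_ge0 ?exprn_ge0.
  have [s0|s0] := ltP s 0; first by rewrite h0// !(mulr0, mul0r) normr0.
  have [r0|r0] := ltP r 0; first by rewrite (h0 r0) !(mulr0, mul0r) normr0.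
  have [st|st] := leP s t; last by rewrite mulr0n !(mulr0, mul0r) normr0.
  have [rt|rt] := leP r t; last by rewrite mulr0n !(mulr0, mul0r) normr0.
  rewrite !mulr1n !mul1r normrM (ger0_norm (discount_ge0 _ _)) normrM.
  rewrite [leRHS]mulrCA [leRHS]mulrC ler_pM ?mulr_ge0 ?discount_ge0//; last first.
    by rewrite expr2 ler_pM.
  rewrite /discount s0 r0 (le_trans s0 st) !mulr1n !mul1r -!expRD ler_expR.
  have : 0 <= beta * (t - s) by rewrite mulr_ge0 ?subr_ge0// ltW.
  have : 0 <= beta * (t - r) by rewrite mulr_ge0 ?subr_ge0// ltW.
  by lra.
transitivity (\int[lambda]_t \int[plane]_z (Phi (t, z))%:E)%E.
  apply: eq_integral => t _; rewrite EFinM expr2 Rintegral_mul_tensor//.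
  have I := integrable_tensor (integrable_stopped t) (integrable_stopped t).
  by rewrite -(@integralZl _ _ _ plane _ _ _ I).
rewrite (Fubini intPhi)/=.
apply: eq_integral => -[s r] _ /=.
have E t : Phi (t, (s, r)) =
    h s * h r * ((Num.max s r <= t)%R%:R * expR (- (beta * t))).
  rewrite /Phi/= ge_max.
  have [s0|s0] := ltP s 0; first by rewrite h0// !(mulr0, mul0r).
  have [st|st] := leP s t; last by rewrite mulr0n !(mulr0, mul0r).
  rewrite /discount (le_trans s0 st)/= !mulr1n !mul1r; ring.
under eq_integral do rewrite E EFinM.
have tail_ge0 t : (0 <= ((Num.max s r <= t)%R%:R * expR (- (beta * t)))%:E)%E.
  by rewrite lee_fin mulr_ge0// expR_ge0.
rewrite integralZl//; first by rewrite integral_discount_tail// -EFinM mulrCA.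
apply/integrableP; split.
  apply/measurable_EFinP/measurable_funM.
    by apply: measurable_natr_bool; exact: measurable_fun_ler.
  by apply: measurableT_comp => //; apply: measurableT_comp => //;
    exact: measurable_funM.
under eq_integral do rewrite gee0_abs//.
by rewrite integral_discount_tail// ltry.
Qed.

End squared_primitive.

Section triangle.
Context (R : realType).
Notation lambda := (@lebesgue_measure R).
Notation plane := (@lebesgue_plane R).
Notation mR := (measurableTypeR R).
Variables (h : mR -> R) (M : R).
Hypotheses (mh : measurable_fun setT h) (hM : forall s, `|h s| <= M)
  (h0 : forall s : R, s < 0 -> h s = 0).
Variables (beta c : R) (beta_gt0 : 0 < beta) (c_gt0 : 0 < c).

Let M_ge0 : 0 <= M. Proof. exact: le_trans (hM 0). Qed.

Let alpha := beta / (2 * c).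
Let alpha_gt0 : 0 < alpha. Proof. by rewrite divr_gt0// mulr_gt0. Qed.
Let b2_gt0 : 0 < beta / 2. Proof. by rewrite divr_gt0. Qed.

(* k is the rescaled path and Psi the integrand of the resolvent form; A and B
   carry the integrand of the quadrant on s <= r and on r < s. *)
Let k (s : mR) : R := expR (- (alpha * s)) * h (s / c).
Let Psi (z : mR * mR) : R := discount alpha z.2 * (k z.1 * k (z.1 + z.2)).
Let A (z : mR * mR) : R :=
  (z.1 <= z.2)%R%:R * (h z.1 * h z.2 * expR (- (beta * z.2))).
Let B (z : mR * mR) : R :=
  (z.2 < z.1)%R%:R * (h z.1 * h z.2 * expR (- (beta * z.1))).

Let mexp (a : R) : measurable_fun setT (fun s : mR => expR (- (a * s))).
Proof.
by do 2 apply: measurableT_comp => //; exact: measurable_funM.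
Qed.

Let mk : measurable_fun setT k.
Proof.
apply: measurable_funM => //; apply: measurableT_comp => //.
exact: measurable_funM.
Qed.

Let mPsi : measurable_fun setT Psi.
Proof.
apply: measurable_funM.
  exact: (measurableT_comp (@measurable_discount R alpha)).
apply: measurable_funM; first exact: measurableT_comp.
by apply: measurableT_comp => //; exact: measurable_funD.
Qed.

Let mA : measurable_fun setT A.
Proof.
apply: measurable_funM.
  by apply: measurable_natr_bool; exact: measurable_fun_ler.
apply: measurable_funM; last exact: (measurableT_comp (mexp beta)).
by apply: measurable_funM; exact: measurableT_comp.
Qed.

Let mB : measurable_fun setT B.
Proof.
apply: measurable_funM.
  by apply: measurable_natr_bool; exact: measurable_fun_ltr.
apply: measurable_funM; last exact: (measurableT_comp (mexp beta)).
by apply: measurable_funM; exact: measurableT_comp.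
Qed.

Let int_scaled (a : R) : 0 < a ->
  lambda.-integrable setT (EFin \o (fun s => M ^+ 2 * discount a s)).
Proof.
move=> a0; have := integrableZl measurableT (M ^+ 2) (integrable_discount a0).
by apply: eq_integrable.
Qed.

Let k_bound s : `|k s| <= M * expR (- (alpha * s)).
Proof. by rewrite normrM (ger0_norm (expR_ge0 _)) mulrC ler_pM2r ?expR_gt0. Qed.

Let k0 s : s < 0 -> k s = 0.
Proof. by move=> s0; rewrite /k h0 ?mulr0// pmulr_llt0 ?invr_gt0. Qed.

Let k_leM s : `|k s| <= M.
Proof.
have [s0|s0] := ltP s 0; first by rewrite k0// normr0.
rewrite (le_trans (k_bound s))// ler_piMr// -expR0 ler_expR oppr_le0.
by rewrite mulr_ge0// ltW.
Qed.

Let intPsi : plane.-integrable setT (EFin \o Psi).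
Proof.
apply: (dominated_integrable_prod mPsi (int_scaled alpha_gt0)
  (integrable_discount alpha_gt0)) => s r.
rewrite /Psi/= normrM (ger0_norm (discount_ge0 _ _)) mulrC.
apply: ler_wpM2r; first exact: discount_ge0.
have [s0|s0] := ltP s 0.
  by rewrite k0// mul0r normr0 mulr_ge0 ?discount_ge0 ?exprn_ge0.
rewrite normrM expr2 [leRHS]mulrC mulrA ler_pM//.
by rewrite /discount s0 mulr1n mul1r mulrC.
Qed.

Let intA : plane.-integrable setT (EFin \o A).
Proof.
apply: (dominated_integrable_prod mA (int_scaled b2_gt0)
  (integrable_discount b2_gt0)) => s r; rewrite /A/=.
have rhs_ge0 : 0 <= M ^+ 2 * discount (beta / 2) s * discount (beta / 2) r.
  by rewrite !mulr_ge0 ?discount_ge0 ?exprn_ge0.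
have [s0|s0] := ltP s 0; first by rewrite h0// !(mulr0, mul0r) normr0.
have [sr|sr] := leP s r; last by rewrite mulr0n mul0r normr0.
rewrite mulr1n mul1r normrM (ger0_norm (expR_ge0 _)) -mulrA.
rewrite ler_pM ?expR_ge0//; first by rewrite normrM expr2 ler_pM.
rewrite /discount s0 (le_trans s0 sr) !mulr1n !mul1r -expRD ler_expR.
have : 0 <= beta * (r - s) by rewrite mulr_ge0 ?subr_ge0// ltW.
by lra.
Qed.

Let intB : plane.-integrable setT (EFin \o B).
Proof.
apply: (dominated_integrable_prod mB (int_scaled b2_gt0)
  (integrable_discount b2_gt0)) => s r; rewrite /B/=.
have rhs_ge0 : 0 <= M ^+ 2 * discount (beta / 2) s * discount (beta / 2) r.
  by rewrite !mulr_ge0 ?discount_ge0 ?exprn_ge0.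
have [r0|r0] := ltP r 0; first by rewrite (h0 r0) !(mulr0, mul0r) normr0.
have [rs|rs] := ltP r s; last by rewrite mulr0n mul0r normr0.
rewrite mulr1n mul1r normrM (ger0_norm (expR_ge0 _)) -mulrA.
rewrite ler_pM ?expR_ge0//; first by rewrite normrM expr2 ler_pM.
rewrite /discount r0 (le_trans r0 (ltW rs)) !mulr1n !mul1r -expRD ler_expR.
have : 0 <= beta * (s - r) by rewrite mulr_ge0 ?subr_ge0// ltW.
by lra.
Qed.

Local Open Scope ereal_scope.

(* B is A with its arguments exchanged, except on the null diagonal. *)
Let integral_B : \int[plane]_z (B z)%:E = \int[plane]_z (A z)%:E.
Proof.
rewrite -(integral21_prod_meas1 intB) -(integral12_prod_meas1 intA).
apply: eq_integral => r _; apply: ae_eq_integral => //.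
- apply/measurable_EFinP.
  by apply: (measurableT_comp mB); exact: pair2_measurable.
- apply/measurable_EFinP.
  by apply: (measurableT_comp mA); exact: pair1_measurable.
- exists [set r]; split; [exact: measurable_set1|exact: lebesgue_measure_set1|].
  move=> s /= /not_implyP[_]; apply: contra_notP => sr; rewrite /A/B/=.
  rewrite lt_neqAle; case: eqP => [rs|_]; first by case: sr.
  by congr _%:E; ring.
Qed.

Let integral_A : \int[plane]_z (A z)%:E = (c ^- 2)%:E * \int[plane]_z (Psi z)%:E.
Proof.
rewrite -(integral12_prod_meas1 intA) -(integral12_prod_meas1 intPsi).
have ci0 : (0 < c^-1)%R by rewrite invr_gt0.
have mG := measurable_int _ (integrable_fubini_F intA).
rewrite (integral_affine 0 ci0 mG) (_ : (c ^- 2)%:E = c^-1%:E * c^-1%:E); last first.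
  by rewrite -EFinM -expr2 exprVn.
rewrite -muleA; congr (_ * _).
rewrite -integralZl//; last exact: integrable_fubini_F intPsi.
apply: eq_integral => s _; rewrite /fubini_F /=.
rewrite (integral_affine (c^-1 * s + 0) ci0); last first.
  by apply/measurable_EFinP/(measurableT_comp mA); exact: pair1_measurable.
congr (_ * _); apply: eq_integral => u _; congr _%:E; rewrite /A /Psi /k /=.
rewrite addr0 lerDr pmulr_rge0// /discount -mulrDr [(u + s)%R]addrC.
rewrite ![(c^-1 * _)%R]mulrC.
have -> : expR (- (beta * ((s + u) / c))) =
    (expR (- (alpha * u)) * expR (- (alpha * s)) * expR (- (alpha * (s + u))))%R.
  by rewrite -!expRD; congr expR; rewrite /alpha; field; rewrite gt_eqF.
by ring.
Qed.

(** The quadrant splits into two triangles of equal contribution, and the triangle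
s <= r is parametrized by (s / c, (s + u) / c) with s, u >= 0. The choice
alpha = beta / (2 c) makes the weight factor as
exp (- alpha u) exp (- alpha s) exp (- alpha (s + u)). *)
Lemma integral_max_triangle :
  \int[plane]_z
    (beta^-1 * (h z.1 * h z.2 * expR (- (beta * Num.max z.1 z.2))))%:E =
  (2 / (beta * c ^+ 2))%:E * \int[plane]_z (Psi z)%:E.
Proof.
transitivity (\int[plane]_z (beta^-1%:E * ((EFin \o A) \+ (EFin \o B)) z)).
  apply: eq_integral => -[s r] _; rewrite -EFinD -EFinM; congr (_ * _)%R%:E.
  rewrite /A /B/=; have [sr|sr] := leP s r.
    by rewrite mulr1n mulr0n mul0r addr0 mul1r.
  by rewrite mulr1n mulr0n mul0r add0r mul1r.
rewrite integralZl//; last exact: integrableD.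
rewrite integralD// integral_B integral_A.
have /fineK <- : \int[plane]_z (Psi z)%:E \is a fin_num.
  exact: integrable_fin_num intPsi.
rewrite -!EFinM; congr _%:E; field.
by rewrite !gt_eqF.
Qed.

End triangle.

(** * Joint measurability of the paths *)

Section paths.
Context (R : realType) (X : ptopologicalType) d (Omega : measurableType d).
Notation mR := (measurableTypeR R).
Variable eta : R -> Omega -> X.

(** The transition probabilities of a right process are Borel measurable on the
sigma-algebra generated by these events, and only universally measurable on the
larger one of the underlying space; kernels are therefore built on
[g_sigma_algebraType path_events]. *)
Definition path_events : set (set Omega) :=
  [set B | exists2 s : R, 0 <= s &
           exists2 A : set (borel X), measurable A & B = eta s @^-1` A].

Notation path_space := (g_sigma_algebraType path_events).

(** Nothing is known of the process at negative times, so the path is extended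
there by its initial value. *)
Definition halted_path (z : mR * path_space) : borel X := eta (Num.max 0 z.1) z.2.

Hypothesis borelX : borel_generated_by_continuous R X.
Hypothesis right_cont : forall (w : Omega) (t : R), 0 <= t ->
    eta s w @[s --> t^'+] --> eta t w.

Lemma measurable_coordinate s : 0 <= s ->
  measurable_fun setT (eta s : path_space -> borel X).
Proof.
move=> s0 _ A mA; rewrite setTI; apply: sub_sigma_algebra.
by exists s => //; exists A.
Qed.

Lemma continuous_borel_measurable (f : X -> R) : continuous f ->
  measurable_fun setT (f : borel X -> R).
Proof.
move=> cf; apply: (measurability _ (RGenOpens.measurableE R)).
move=> _ [_ [a [b ->] <-]]; rewrite setTI.
apply: sub_sigma_algebra; apply: open_comp; last exact: interval_open.
by move=> x _; exact: cf.
Qed.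

Let max_ge0 (t : R) : 0 <= Num.max 0 t. Proof. by rewrite le_max lexx. Qed.

(* The least multiple of 1 / (n + 1) that is strictly greater than max (0, t):
   these times converge to max (0, t) strictly from the right. *)
Let mesh_time n (t : R) : R :=
  (Num.truncn (n.+1%:R * Num.max 0 t)).+1%:R / n.+1%:R.

Let mesh_time_gt n t : Num.max 0 t < mesh_time n t.
Proof.
rewrite /mesh_time ltr_pdivlMr// mulrC.
by have /andP[] := truncn_itv (mulr_ge0 (ler0n R n.+1) (max_ge0 t)).
Qed.

Let mesh_time_le n t : mesh_time n t <= Num.max 0 t + n.+1%:R^-1.
Proof.
rewrite /mesh_time ler_pdivrMr// mulrDl mulVf// -natr1 lerD2r [leRHS]mulrC.
by have /andP[] := truncn_itv (mulr_ge0 (ler0n R n.+1) (max_ge0 t)).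
Qed.

Let mesh_time_cvg t : mesh_time n t @[n --> \oo] --> Num.max 0 t.
Proof.
apply: (@squeeze_cvgr _ _ _ _ (fun=> Num.max 0 t)
  (fun n => Num.max 0 t + n.+1%:R^-1)).
- by near=> n; rewrite ltW ?mesh_time_gt// mesh_time_le.
- exact: cvg_cst.
- rewrite -[X in _ --> X]addr0; apply: cvgD; [exact: cvg_cst|exact: cvg_harmonic].
Unshelve. all: by end_near. Qed.

Let measurable_continuous_halted_path (f : X -> R) : continuous f ->
  measurable_fun setT (f \o halted_path : mR * path_space -> R).
Proof.
move=> cf.
apply: (@measurable_fun_cvg _ _ _ _
  (fun n (z : mR * path_space) => f (eta (mesh_time n z.1) z.2))).
- move=> n _ B mB; rewrite setTI.
  pose I k : set mR := [set t | Num.truncn (n.+1%:R * Num.max 0 t) = k].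
  rewrite (_ : _ @^-1` B =
    \bigcup_k (I k `*` ((f \o eta (k.+1%:R / n.+1%:R)) @^-1` B))); last first.
    apply/seteqP; split => [[t w] /= Bz|[t w] [k _ [/= <-]]//].
    by exists (Num.truncn (n.+1%:R * Num.max 0 t)).
  apply: bigcup_measurable => k _; apply: measurableX.
    rewrite (_ : I k =
      (fun t => n.+1%:R * Num.max 0 t) @^-1` `[k%:R, k.+1%:R[); last first.
      apply/seteqP; split => t /=; rewrite in_itv/= -truncn_eq ?mulr_ge0//.
        by move=> ->.
      by move/eqP.
    rewrite -[X in measurable X]setTI.
    have mm : measurable_fun setT (fun t : mR => n.+1%:R * Num.max 0 t).
      by apply: measurable_funM => //; exact: measurable_maxr.
    by apply: mm => //; exact: measurable_itv.
  rewrite -[X in measurable X]setTI.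
  have : measurable_fun setT (f \o eta (k.+1%:R / n.+1%:R) : path_space -> R).
    apply: (measurableT_comp (continuous_borel_measurable cf)).
    by apply: measurable_coordinate; rewrite divr_ge0.
  exact.
- move=> [t w] _ /=.
  have := cvg_comp _ _ (@right_cont w _ (max_ge0 t)) (cf _).
  move=> /cvg_at_rightP; apply; split => [n|]; first exact: mesh_time_gt.
  exact: mesh_time_cvg.
Qed.

(** For continuous [f], right continuity makes [f] of the path the limit of its
values along times of a countable mesh, which are jointly measurable. Preimages
under continuous functions generate the Borel sets, so this is enough. *)
Lemma measurable_halted_path : measurable_fun setT halted_path.
Proof.
move=> _ A mA; rewrite setTI.
have : <<s @open X >> A by exact: mA.
rewrite borelX.
suff : <<s [set A | exists2 f : X -> R, continuous f &
  exists2 B : set R, measurable B & A = f @^-1` B] >> `<=`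
  [set A | measurable (halted_path @^-1` A)] by apply.
apply: smallest_sub; last first.
  move=> _ [f cf [B mB ->]] /=; have := measurable_continuous_halted_path cf.
  by move/(_ measurableT _ mB); rewrite setTI.
split => /=.
- by rewrite preimage_set0.
- by move=> B mB; rewrite setTD -preimage_setC; exact: measurableC.
- by move=> B mB; rewrite preimage_bigcup; exact: bigcup_measurable.
Qed.

End paths.

(** * Expectations as functions of the starting point *)

Section process.
Local Open Scope ereal_scope.
Context (R : realType) (X : ptopologicalType) d (Omega : measurableType d).
Variables (P : ukernel (borel X) Omega R) (F : R -> set (set Omega)).
Variable eta : R -> Omega -> X.
Hypothesis rp : right_process P F eta.
Notation path_space := (g_sigma_algebraType (path_events eta)).

Lemma measurable_path : measurable_fun setT (id : Omega -> path_space).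
Proof.
have [_ Fm _] := rp_filtration rp.
move=> _ A mA; rewrite setTI preimage_id.
suff : <<s path_events eta >> `<=` (measurable : set (set Omega)) by apply.
apply: smallest_sub; first exact: sigma_algebra_measurable.
move=> _ [s s0 [B mB ->]]; apply: (Fm s s0); exact: (rp_adapted rp).
Qed.

Lemma measurable_state s : (0 <= s)%R ->
  measurable_fun setT (eta s : Omega -> borel X).
Proof.
move=> s0; have ms : measurable_fun setT (eta s : path_space -> borel X).
  exact: measurable_coordinate.
exact: (measurableT_comp ms measurable_path).
Qed.

Section path_kernel.
Context dE (E : measurableType dE) (start : E -> borel X).
Hypothesis mstart : measurable_fun setT start.

Let path_kernel (e : E) : {measure set path_space -> \bar R}.
Proof.
refine (pushforward (P (start e)) (id : Omega -> path_space) :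
  {measure set _ -> \bar R}).
exact: measurable_path.
Defined.

Let measurable_path_kernel U : measurable U ->
  measurable_fun setT (fun e => path_kernel e U).
Proof.
move=> mU; apply: (measurableT_comp (f := fun x : borel X => P x U)) => //.
exact: (rp_measurable rp).
Qed.

HB.instance Definition _ := isKernel.Build _ _ _ _ _ path_kernel measurable_path_kernel.

Let path_kernel_uub : measure_fam_uub path_kernel.
Proof.
exists 2%R => e; rewrite /path_kernel/= /pushforward preimage_setT.
by rewrite probability_setT lte_fin ltr1n.
Qed.

HB.instance Definition _ := Kernel_isFinite.Build _ _ _ _ _ path_kernel path_kernel_uub.

Lemma ge0_measurable_expectation (g : E * path_space -> \bar R) :
  measurable_fun setT g -> (forall z, 0 <= g z) ->
  measurable_fun setT (fun e => \int[P (start e)]_w g (e, w)).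
Proof.
move=> mg g0.
have := measurable_fun_integral_finite_kernel g path_kernel g0 mg.
congr (measurable_fun _ _); apply/funext => e.
rewrite /path_kernel/= ge0_integral_pushforward//; first exact: measurable_path.
exact: measurableT_comp.
Qed.

Lemma measurable_expectation (g : E * path_space -> R) :
  measurable_fun setT g ->
  measurable_fun setT (fun e => \int[P (start e)]_w (g (e, w))%:E).
Proof.
move=> mg; have mEg : measurable_fun setT (EFin \o g) by exact/measurable_EFinP.
under eq_fun do rewrite integralE.
apply: emeasurable_funB.
- have := ge0_measurable_expectation (measurable_funepos mEg)
    (fun=> funepos_ge0 _ _).
  congr (measurable_fun _ _); apply/funext => e.
  by apply: eq_integral => w _; rewrite !funeposE.
- have := ge0_measurable_expectation (measurable_funeneg mEg)
    (fun=> funeneg_ge0 _ _).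
  congr (measurable_fun _ _); apply/funext => e.
  by apply: eq_integral => w _; rewrite !funenegE.
Qed.

End path_kernel.

End process.

(** * The Markov property at two times *)

Section bounded_probability.
Local Open Scope ereal_scope.
Context d (T : measurableType d) (R : realType) (Q : probability T R).
Variables (f : T -> R) (M : R).
Hypotheses (mf : measurable_fun setT f) (fM : forall x, (`|f x| <= M)%R).

Lemma bounded_integrable : Q.-integrable setT (EFin \o f).
Proof.
apply: le_integrable (finite_measure_integrable_cst Q M measurableT) => //.
  exact/measurable_EFinP.
by move=> x _ /=; rewrite lee_fin (le_trans (fM x))// ler_norm.
Qed.

Lemma bounded_expectation_le : (`|fine (\int[Q]_x (f x)%:E)| <= M)%R.
Proof.
have fin := integrable_fin_num measurableT bounded_integrable.
rewrite -lee_fin -fine_abse// fineK ?abse_fin_num//.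
apply: (le_trans (le_abse_integral _ measurableT _)); first exact/measurable_EFinP.
apply: (@le_trans _ _ (\int[Q]_x M%:E)).
  apply: ge0_le_integral => //.
  - by apply/measurable_EFinP; exact: measurableT_comp.
  - by move=> x _; rewrite lee_fin (le_trans _ (fM x)).
rewrite (integral_cst Q measurableT M%:E).
by rewrite [X in _ * X](_ : _ = 1) ?mule1//; exact: probability_setT.
Qed.

Lemma expectationD_cst (a : R) :
  \int[Q]_x (f x + a)%:E = \int[Q]_x (f x)%:E + a%:E.
Proof.
under eq_integral do rewrite EFinD.
rewrite integralD//; [|exact: bounded_integrable|exact: finite_measure_integrable_cst].
rewrite integral_cst// [X in _ * X](_ : _ = 1) ?mule1//.
exact: probability_setT.
Qed.

End bounded_probability.

Section markov.
Local Open Scope ereal_scope.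
Context (R : realType) (X : ptopologicalType) d (Omega : measurableType d).
Variables (P : ukernel (borel X) Omega R) (F : R -> set (set Omega)).
Variables (eta : R -> Omega -> X) (nu : probability (borel X) R).
Hypotheses (rp : right_process P F eta) (inv : invariant_state P eta nu).
Variables (s r : R) (s0 : (0 <= s)%R) (r0 : (0 <= r)%R).
Notation m := (mixture P nu).
Notation path_space := (g_sigma_algebraType (path_events eta)).

Let ms := measurable_state rp s0.
Let mr := measurable_state rp r0.
Let msr : measurable_fun setT (eta (s + r) : Omega -> borel X).
Proof. by apply: (measurable_state rp); exact: addr_ge0. Qed.

Lemma ge0_expectation_state (f : borel X -> \bar R) (A : set (borel X)) :
  measurable A -> measurable_fun setT f -> (forall x, 0 <= f x) ->
  \int[m]_(w in eta s @^-1` A) f (eta s w) = \int[nu]_(x in A) f x.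
Proof.
move=> mA mf f0.
rewrite -(ge0_integral_pushforward ms)//; last exact: measurable_funTS.
apply: eq_measure_integral => // B mB _; rewrite /pushforward.
exact: inv.
Qed.

(* The strong Markov property at the constant time s, under the law of the process
   with initial distribution nu. *)
Let transition_event (A B : set (borel X)) : measurable A -> measurable B ->
  m (eta (s + r) @^-1` B `&` eta s @^-1` A) =
  \int[nu]_(x in A) P x (eta r @^-1` B).
Proof.
move=> mA mB.
have [Fsigma Fm Fmono] := rp_filtration rp.
have FT t : (0 <= t)%R -> F t setT.
  by move=> t0; have [F0 FC _] := Fsigma t t0; rewrite -setC0 -setTD; exact: FC.
have F0 t : (0 <= t)%R -> F t set0 by move=> t0; have [] := Fsigma t t0.
have stop : stopping_time F (fun=> s%:E).
  split=> [w|t t0]; first by rewrite lee_fin.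
  have [st|st] := boolP (s%:E <= t%:E).
    by rewrite (_ : [set _ | _] = setT); [exact: FT|exact/seteqP].
  rewrite (_ : [set _ | _] = set0); [exact: F0|].
  by apply/seteqP; split=> // w /=; rewrite (negbTE st).
have sA : stopped_sigma_algebra F (fun=> s%:E) (eta s @^-1` A).
  split; first by rewrite -[X in measurable X]setTI; exact: ms.
  move=> t t0; have [st|st] := boolP (s%:E <= t%:E).
    rewrite (_ : [set _ | _] = setT) ?setIT; last exact/seteqP.
    by apply: (Fmono s t) => //; exact: (rp_adapted rp).
  rewrite (_ : [set _ | _] = set0) ?setI0; first exact: F0.
  by apply/seteqP; split=> // w /=; rewrite (negbTE st).
have [_ /(_ _ sA)] := rp_strong_markov rp nu stop r0 mB.
rewrite (_ : stopped_event _ _ _ _ = eta (s + r) @^-1` B); last first.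
  by apply/seteqP; split => w /=; [move=> [_ [<-]]|exists s].
move=> ->; apply: (@ge0_expectation_state (fun x => P x (eta r @^-1` B))) => //.
apply: (rp_measurable rp); apply: sub_sigma_algebra.
by exists r => //; exists B.
Qed.

(* The joint law of (eta_s, eta_{s+r}) is compared with the law of the pair formed
   by a point x drawn from nu and the position at time r of the process started
   at x. The latter is a composition of kernels over a one-point space. *)
Let base (_ : unit) : {measure set (borel X) -> \bar R} := nu.

HB.instance Definition _ := isKernel.Build _ _ _ _ _ base
  (fun U _ => measurable_cst _).

Let base_uub : measure_fam_uub base.
Proof.
exists 2%R => e; have -> : base e setT = 1 by exact: probability_setT.
by rewrite lte_fin ltr1n.
Qed.

HB.instance Definition _ := Kernel_isFinite.Build _ _ _ _ _ base base_uub.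

Let mpair x : measurable_fun setT
  (fun w => (x, eta r w) : (borel X * borel X)%type).
Proof. exact/measurable_fun_pair. Qed.

Let pair_law (z : unit * borel X) : {measure set (borel X * borel X) -> \bar R}.
Proof.
refine (pushforward (P z.2) (fun w => (z.2, eta r w) : (borel X * borel X)%type) :
  {measure set _ -> \bar R}).
exact: mpair.
Defined.

Let measurable_pair_law U : measurable U ->
  measurable_fun setT (fun z => pair_law z U).
Proof.
move=> mU.
pose g (y : (unit * borel X) * path_space) : \bar R :=
  (\1_U ((y.1.2 : borel X), (eta r y.2 : borel X)))%:E.
have mg : measurable_fun setT g.
  apply/measurable_EFinP; apply: (measurableT_comp (measurable_indic mU)).
  apply/measurable_fun_pair; first exact: measurableT_comp.
  by apply: (measurableT_comp (measurable_coordinate r0)).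
have g0 y : 0 <= g y by rewrite lee_fin.
have := ge0_measurable_expectation rp (start := snd) measurable_snd mg g0.
congr (measurable_fun _ _); apply/funext => -[u x].
rewrite /pair_law/= /pushforward -[X in _ = P x X]setIT -integral_indic//.
by rewrite -[X in measurable X]setTI; exact: mpair.
Qed.

HB.instance Definition _ := isKernel.Build _ _ _ _ _ pair_law measurable_pair_law.

Let pair_law_uub : measure_fam_uub pair_law.
Proof.
exists 2%R => z; have -> : pair_law z setT = 1.
  by rewrite /pair_law/= /pushforward preimage_setT probability_setT.
by rewrite lte_fin ltr1n.
Qed.

HB.instance Definition _ := Kernel_isFinite.Build _ _ _ _ _ pair_law pair_law_uub.

Let mjoint : measurable_fun setT
  (fun w => (eta s w, eta (s + r) w) : (borel X * borel X)%type).
Proof. exact/measurable_fun_pair. Qed.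

Let joint_law : {measure set (borel X * borel X) -> \bar R}.
Proof.
refine (pushforward m
  (fun w => (eta s w, eta (s + r) w) : (borel X * borel X)%type) :
  {measure set _ -> \bar R}).
exact: mjoint.
Defined.

(* Two finite measures on a product that agree on measurable rectangles. *)
Let joint_lawE (C : set (borel X * borel X)) : measurable C ->
  joint_law C = (base \; pair_law) tt C.
Proof.
pose rect : set (set (borel X * borel X)) :=
  [set A `*` B | A in measurable & B in measurable].
have rectI : setI_closed rect.
  move=> _ _ [A mA [B mB <-]] [A' mA' [B' mB' <-]]; rewrite -setXI.
  by exists (A `&` A'); [exact: measurableI|exists (B `&` B') => //; exact: measurableI].
have rectT : rect setT by exists setT => //; exists setT => //; rewrite setXTT.
apply: (measure_unique rect (fun=> setT)) => //.
- exact: measurable_prod_measurableType.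
- by rewrite bigcup_const.
- move=> _ [A mA [B mB <-]].
  rewrite /joint_law/= /pushforward.
  transitivity (m (eta (s + r) @^-1` B `&` eta s @^-1` A)).
    by congr (m _); apply/seteqP; split => w /= [].
  rewrite transition_event// /mkcomp/= /kcomp/= integral_mkcond.
  apply: eq_integral => x _; rewrite patchE /pair_law/= /pushforward.
  have [xA|xA] := boolP (x \in A).
    congr (P x _); apply/seteqP; split => w /=; last by case.
    by split => //; exact: set_mem.
  rewrite (_ : _ @^-1` _ = set0) ?measure0//; apply/seteqP; split => // w /= [].
  by move/mem_set; rewrite (negbTE xA).
- move=> _; rewrite /joint_law/= /pushforward preimage_setT probability_setT.
  exact: ltry.
Qed.

Lemma ge0_two_time_expectation (g : borel X * borel X -> \bar R) :
  measurable_fun setT g -> (forall z, 0 <= g z) ->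
  \int[m]_w g (eta s w, eta (s + r) w) =
  \int[nu]_x \int[P x]_w g (x, eta r w).
Proof.
move=> mg g0.
transitivity (\int[joint_law]_z g z).
  by rewrite /joint_law/= ge0_integral_pushforward.
rewrite (eq_measure_integral _ (fun C mC _ => joint_lawE mC)).
rewrite /= (integral_kcomp base pair_law tt g0 mg).
apply: eq_integral => x _; rewrite /pair_law/= ge0_integral_pushforward//.
Qed.

(** The case of a nonnegative function applies to [g + M]; all measures being
probabilities, the constant [M] then cancels. *)
Lemma two_time_expectation (g : borel X * borel X -> R) (M : R) :
  measurable_fun setT g -> (forall z, (`|g z| <= M)%R) ->
  \int[m]_w (g (eta s w, eta (s + r) w))%:E =
  \int[nu]_x \int[P x]_w (g (x, eta r w))%:E.
Proof.
move=> mg gM.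
have mgP x : measurable_fun setT (fun w => g (x, eta r w)).
  exact: (measurableT_comp mg (mpair x)).
have gP x := bounded_integrable (P x) (mgP x) (fun=> gM _).
have finP x := integrable_fin_num measurableT (gP x).
have mE : measurable_fun setT (fun x => fine (\int[P x]_w (g (x, eta r w))%:E)).
  apply/measurable_EFinP.
  rewrite (_ : _ \o _ = fun x => \int[P x]_w (g (x, eta r w))%:E); last first.
    by apply/funext => x /=; rewrite fineK// finP.
  have mg' : measurable_fun setT (fun y : borel X * path_space => g (y.1, eta r y.2)).
    apply: (measurableT_comp mg); apply/measurable_fun_pair => //.
    by apply: (measurableT_comp (measurable_coordinate r0)).
  exact: (measurable_expectation rp (start := idfun) (@measurable_id _ _ setT) mg').
have := @ge0_two_time_expectation (fun z => (g z + M)%:E).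
rewrite (expectationD_cst m (measurableT_comp mg mjoint) (fun=> gM _)).
have -> : \int[nu]_x \int[P x]_w (g (x, eta r w) + M)%:E =
    \int[nu]_x (fine (\int[P x]_w (g (x, eta r w))%:E) + M)%:E.
  apply: eq_integral => x _; rewrite EFinD (fineK (finP x)).
  by rewrite (expectationD_cst (P x) (mgP x) (fun w => gM (x, eta r w))).
have -> : \int[nu]_x (fine (\int[P x]_w (g (x, eta r w))%:E) + M)%:E =
    \int[nu]_x \int[P x]_w (g (x, eta r w))%:E + M%:E.
  rewrite (expectationD_cst nu mE (fun x =>
    bounded_expectation_le (P x) (mgP x) (fun w => gM (x, eta r w)))).
  by congr (_ + _); apply: eq_integral => x _; exact: fineK (finP x).
move=> H; rewrite -[LHS](@addeK R M%:E _ isT) H ?addeK//.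
  by apply/measurable_EFinP; exact: measurable_funD.
move=> z; rewrite lee_fin -(opprK M) subr_ge0.
by have := gM z; rewrite ler_norml => /andP[].
Qed.

End markov.

(** * The space-time measure *)

Section halfline.
Context (R : realType).
Notation lambda := (@lebesgue_measure R).
Notation mR := (measurableTypeR R).
Notation H := (@lebesgue_halfline R).
Local Open Scope ereal_scope.

Let halfline_sigma_finite : sigma_finite setT H.
Proof.
have [S ST S_fin] := sigma_finiteT lambda.
exists S => // n; have [mS Soo] := S_fin n; split => //.
rewrite /lebesgue_halfline/= /mrestr (le_lt_trans _ Soo)//.
by rewrite le_measure ?inE//; apply: measurableI.
Qed.

HB.instance Definition _ := Measure_isSigmaFinite.Build _ _ _
  H halfline_sigma_finite.

Lemma integral_halfline (f : mR -> \bar R) : (forall s : R, (s < 0)%R -> f s = 0) ->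
  \int[H]_s f s = \int[lambda]_s f s.
Proof.
move=> f0; have fE : f = f \_ `[0%R, +oo[%classic.
  apply/funext => s; rewrite patchE mem_setE in_itv/= andbT.
  by case: leP => // /f0.
rewrite fE -!integral_mkcond; apply: eq_measure_integral => A mA A0.
by rewrite -[LHS]/(lambda (A `&` `[0%R, +oo[%classic)) setIidl.
Qed.

Lemma integrable_halfline_discount (a : R) : (0 < a)%R ->
  H.-integrable setT (EFin \o discount a).
Proof.
move=> a0; have /integrableP[md doo] := integrable_discount a0.
apply/integrableP; split => //; rewrite integral_halfline// => s s0.
by rewrite /= /discount leNgt s0 mul0r normr0.
Qed.

Context (X : ptopologicalType) (nu : probability (borel X) R).
Notation ell_nu := (space_time_measure nu).

Lemma negative_times_null : ell_nu.-negligible [set z : space_time R X | (z.1 < 0)%R].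
Proof.
exists (`]-oo, 0%R[%classic `*` setT); split.
- by apply: measurableX.
- rewrite /space_time_measure product_measure1E//.
  rewrite [X in X * _](_ : _ = 0) ?mul0e//.
  rewrite -[LHS]/(lambda (_ `&` `[0%R, +oo[%classic)) (_ : _ `&` _ = set0) ?measure0//.
  apply/seteqP; split => // s []; rewrite /= !in_itv/= andbT => s0.
  by rewrite leNgt s0.
- by move=> [s x] /= s0; rewrite in_itv.
Qed.

(** Functions on space-time are constrained at nonnegative times only; cutting them
off makes bounds hold everywhere without changing their class in L2. *)
Definition after0 (V : space_time R X -> R) (z : space_time R X) : R :=
  ((0 <= (z.1 : R))%R%:R * V z)%R.

Lemma measurable_after0 V : measurable_fun setT V -> measurable_fun setT (after0 V).
Proof.
move=> mV; apply: measurable_funM => //.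
by apply: measurable_natr_bool; exact: measurable_fun_ler.
Qed.

(** Boundedness and exponential damping in time give square integrability, nu
being a probability; this puts the rescaled function in the domain of the
resolvent. *)
Lemma discounted_Lfun2 (W : space_time R X -> R) (M a : R) : (0 < a)%R ->
  measurable_fun setT W -> (forall z, (`|after0 W z| <= M * discount a z.1)%R) ->
  W \in Lfun ell_nu 2%:E.
Proof.
move=> a0 mW WM; rewrite inE; apply/andP; split; rewrite inE//=.
rewrite /finite_norm unlock; apply: poweR_lty.
have mp (f : space_time R X -> R) : measurable_fun setT f ->
    measurable_fun setT (fun z => `|(EFin \o f) z| `^ 2).
  move=> mf; apply/measurable_EFinP.
  apply: (@measurableT_comp _ _ _ _ _ _ (fun x : R => x `^ 2)%R) => //.
  exact/measurableT_comp.
rewrite (_ : \int[_]_x _ = \int[ell_nu]_z (`|(EFin \o after0 W) z| `^ 2)); last first.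
  apply: ge0_ae_eq_integral => //.
  - exact: mp.
  - by apply: mp; exact: measurable_after0.
  - by move=> z _; exact: poweR_ge0.
  - by move=> z _; exact: poweR_ge0.
  apply: negligibleS negative_times_null => z /= /not_implyP[_].
  apply: contra_notP => /negP; rewrite -leNgt => s0.
  by rewrite /after0 s0 mul1r.
apply: (@le_lt_trans _ _ (\int[ell_nu]_z (M ^+ 2 * discount a z.1 * 1)%:E)).
  apply: ge0_le_integral => //.
  - by move=> z _; exact: poweR_ge0.
  - by apply: mp; exact: measurable_after0.
  - apply/measurable_EFinP; apply: measurable_funM => //.
    apply: measurable_funM => //.
    exact: (measurableT_comp (@measurable_discount R a)).
  move=> z _; rewrite /= powR_mulrn// lee_fin mulr1.
  have M0 : (0 <= M)%R.
    have := le_trans (normr_ge0 _) (WM (0%R, point)).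
    by rewrite /discount lexx mulr0 oppr0 expR0 !mulr1.
  apply: (@le_trans _ _ ((M * discount a z.1) ^+ 2)%R).
    by rewrite lerXn2r ?nnegrE ?mulr_ge0 ?discount_ge0.
  rewrite exprMn ler_wpM2l ?exprn_ge0// expr2 ler_piMr ?discount_ge0//.
  by rewrite discount_le1// ltW.
have I1 : H.-integrable setT (EFin \o (fun s => M ^+ 2 * discount a s)%R).
  have := integrableZl measurableT (M ^+ 2) (integrable_halfline_discount a0).
  by apply: eq_integrable.
have I2 := finite_measure_integrable_cst nu 1 measurableT.
exact: (integrable_lty measurableT (integrable_tensor I1 I2)).
Qed.

End halfline.

(** * The resolvent as a correlation integral *)

Section resolvent_form.
Context (R : realType) (X : ptopologicalType) d (Omega : measurableType d).
Variables (P : ukernel (borel X) Omega R) (F : R -> set (set Omega)).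
Variables (eta : R -> Omega -> X) (nu : probability (borel X) R).
Hypotheses (borelX : borel_generated_by_continuous R X)
  (rp : right_process P F eta) (inv : invariant_state P eta nu).
Notation lambda := (@lebesgue_measure R).
Notation plane := (@lebesgue_plane R).
Notation mR := (measurableTypeR R).
Notation H := (@lebesgue_halfline R).
Notation m := (mixture P nu).
Notation ell_nu := (space_time_measure nu).
Notation path_space := (g_sigma_algebraType (path_events eta)).
Notation xi := (@halted_path R X d Omega eta).

Variables (W : space_time R X -> R) (M alpha : R).
Hypotheses (mW : measurable_fun setT W) (alpha_gt0 : 0 < alpha)
  (WM : forall z, `|after0 W z| <= M * discount alpha z.1).
Let U := after0 W.
Let mU : measurable_fun setT U. Proof. exact: measurable_after0. Qed.

Let M_ge0 : 0 <= M.
Proof.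
have := le_trans (normr_ge0 _) (WM (0, point)).
by rewrite /discount lexx mulr0 oppr0 expR0 !mulr1.
Qed.

Let U_leM z : `|U z| <= M.
Proof. by rewrite (le_trans (WM z))// ler_piMr// discount_le1// ltW. Qed.

Let U_neg (s : R) x : s < 0 -> U (s, x) = 0.
Proof. by move=> s0; rewrite /U /after0/= leNgt s0 mul0r. Qed.

Let xiE (s : R) (w : Omega) : 0 <= s -> xi (s, w) = eta s w.
Proof. by move=> s0; rewrite /halted_path/= max_r. Qed.

Let mxi : measurable_fun setT xi.
Proof. exact: measurable_halted_path borelX (rp_right_continuous rp). Qed.

(** At (s, u), the product of the values of [W] along the path at times s and
s + u, weighted by the discount of the resolvent. *)
Definition correlation (w : Omega) (z : mR * mR) : R :=
  discount alpha z.2 * (U (z.1, xi (z.1, w)) * U (z.1 + z.2, xi (z.1 + z.2, w))).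

Lemma measurable_correlation :
  measurable_fun setT (fun y : (mR * mR) * Omega => correlation y.2 y.1).
Proof.
have mt (t : (mR * mR) * Omega -> mR) : measurable_fun setT t ->
    measurable_fun setT (fun y => U (t y, xi (t y, y.2))).
  move=> mt; apply: (measurableT_comp mU); apply/measurable_fun_pair => //.
  apply: (measurableT_comp mxi); apply/measurable_fun_pair => //.
  exact: (measurableT_comp (measurable_path rp) measurable_snd).
have m1 : measurable_fun setT (fun y : (mR * mR) * Omega => y.1.1).
  exact: measurableT_comp.
have m2 : measurable_fun setT (fun y : (mR * mR) * Omega => y.1.2).
  exact: measurableT_comp.
apply: measurable_funM.
  exact: (measurableT_comp (@measurable_discount R alpha)).
apply: measurable_funM; first exact: (mt _ m1).
by apply: (mt (fun y => y.1.1 + y.1.2)); exact: measurable_funD.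
Qed.

Lemma integrable_correlation :
  (plane \x m)%E.-integrable setT
    (EFin \o (fun y => correlation y.2 y.1)).
Proof.
have I1 := integrable_discount alpha_gt0.
have I2 : plane.-integrable setT
    (EFin \o (fun z => M ^+ 2 * (discount alpha z.1 * discount alpha z.2))).
  have := integrableZl measurableT (M ^+ 2) (integrable_tensor I1 I1).
  by apply: eq_integrable.
apply: (dominated_integrable_prod measurable_correlation
  I2 (finite_measure_integrable_cst m 1 measurableT)) => -[s r] w /=.
rewrite /correlation mulr1/= normrM (ger0_norm (discount_ge0 _ _)) normrM.
rewrite [leRHS]mulrA [leRHS]mulrC ler_wpM2l ?discount_ge0//.
by rewrite expr2 -mulrA [leRHS]mulrC ler_pM.
Qed.

(* At ((s, r), x) with s, r >= 0, the space-time semigroup at time r applied to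
   W, evaluated at (s, x). *)
Let D (y : (mR * mR) * borel X) : R :=
  fine (\int[P y.2]_w (U (y.1.1 + y.1.2, xi (y.1.2, w)))%:E).

Let U_path_measurable (s r : R) :
  measurable_fun setT (fun w : Omega => U (s + r, xi (r, w))).
Proof.
apply: (measurableT_comp mU); apply/measurable_fun_pair => //.
apply: (measurableT_comp mxi); apply/measurable_fun_pair => //.
exact: (measurable_path rp).
Qed.

Let D_leM y : `|D y| <= M.
Proof. by apply: bounded_expectation_le => //; exact: U_path_measurable. Qed.

Let mD : measurable_fun setT D.
Proof.
apply: (measurableT_comp (fine_measurable measurableT)).
have mg : measurable_fun setT (fun y : ((mR * mR) * borel X) * path_space =>
    U (y.1.1.1 + y.1.1.2, xi (y.1.1.2, y.2))).
  have m1 : measurable_fun setT (fun y : ((mR * mR) * borel X) * path_space => y.1.1.1).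
    by apply: measurableT_comp => //; exact: measurableT_comp.
  have m2 : measurable_fun setT (fun y : ((mR * mR) * borel X) * path_space => y.1.1.2).
    by apply: measurableT_comp => //; exact: measurableT_comp.
  apply: (measurableT_comp mU); apply/measurable_fun_pair.
    exact: measurable_funD.
  by apply: (measurableT_comp mxi); exact/measurable_fun_pair.
exact: (measurable_expectation rp (start := snd) measurable_snd mg).
Qed.

Let Gam (s : R) (y : borel X * mR) : R :=
  U (s, y.1) * (discount alpha y.2 * D ((s, y.2), y.1)).

Let mGam s : measurable_fun setT (Gam s).
Proof.
apply: measurable_funM; first by apply: (measurableT_comp mU); exact/measurable_fun_pair.
apply: measurable_funM; first exact: (measurableT_comp (@measurable_discount R alpha)).
apply: (measurableT_comp mD); apply/measurable_fun_pair => //.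
exact/measurable_fun_pair.
Qed.

Let intGam s : (nu \x lambda)%E.-integrable setT (EFin \o Gam s).
Proof.
have I1 := finite_measure_integrable_cst nu (M * M) measurableT.
apply: (dominated_integrable_prod (mGam s) I1 (integrable_discount alpha_gt0)) => x r.
rewrite /Gam/= mulrCA normrM (ger0_norm (discount_ge0 _ _)) mulrC.
by rewrite ler_wpM2r ?discount_ge0// normrM ler_pM.
Qed.

Local Open Scope ereal_scope.

Let markov_Gam (s r : R) :
  \int[nu]_x (Gam s (x, r))%:E = \int[m]_w (correlation w (s, r))%:E.
Proof.
have [s0|s0] := ltP s 0%R.
  rewrite !integral0_eq// => [w|x] _; rewrite /correlation/Gam/= U_neg//.
    by rewrite mul0r mulr0.
  by rewrite mul0r.
have [r0|r0] := ltP r 0%R.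
  rewrite !integral0_eq// => [w|x] _; rewrite /correlation/Gam/= lt0_discount//.
    by rewrite mul0r.
  by rewrite mul0r mulr0.
have mg : measurable_fun setT (fun z : borel X * borel X =>
    (discount alpha r * (U (s, z.1) * U (s + r, z.2)))%R).
  apply: measurable_funM => //; apply: measurable_funM;
    by apply: (measurableT_comp mU); exact/measurable_fun_pair.
have gM z : (`|discount alpha r * (U (s, z.1) * U (s + r, z.2))| <= 1 * (M * M))%R.
  rewrite normrM (ger0_norm (discount_ge0 _ _)) ler_pM ?discount_ge0//.
    by rewrite discount_le1// ltW.
  by rewrite normrM ler_pM.
have := two_time_expectation rp inv s0 r0 mg gM.
rewrite (_ : \int[m]_w _ = \int[m]_w (correlation w (s, r))%:E); last first.
  by apply: eq_integral => w _; rewrite /correlation/= !xiE ?addr_ge0.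
move=> ->; apply: eq_integral => x _; rewrite /Gam /D/=.
have I := bounded_integrable (P x) (U_path_measurable s r) (fun=> U_leM _).
rewrite mulrCA mulrA EFinM fineK; last exact: (integrable_fin_num measurableT I).
rewrite -integralZl//; apply: eq_integral => w _.
by rewrite -EFinM xiE// mulrA.
Qed.

(* The product of W with its resolvent at nonnegative times, and 0 elsewhere. *)
Let Theta (z : space_time R X) : R :=
  (\int[lambda]_r Gam z.1 (z.2, r))%R.

Let mTheta : measurable_fun setT Theta.
Proof.
apply: (@measurable_Rintegral_section _ _ _ _ _ lambda
  (fun y : space_time R X * mR => Gam y.1.1 (y.1.2, y.2))).
have m1 : measurable_fun setT (fun y : space_time R X * mR => y.1.1).
  exact: measurableT_comp.
have m2 : measurable_fun setT (fun y : space_time R X * mR => y.1.2).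
  exact: measurableT_comp.
apply: measurable_funM; first by apply: (measurableT_comp mU); exact/measurable_fun_pair.
apply: measurable_funM.
  exact: (measurableT_comp (@measurable_discount R alpha) measurable_snd).
apply: (measurableT_comp mD); apply/measurable_fun_pair => //.
by apply/measurable_fun_pair => //; exact: measurable_snd.
Qed.

Let intGam1 (z : space_time R X) :
  lambda.-integrable setT (fun r => (Gam z.1 (z.2, r))%:E).
Proof.
have := integrableZl measurableT (M * M)%R (integrable_discount alpha_gt0).
apply: le_integrable => //.
  apply/measurable_EFinP; apply: (measurableT_comp (mGam z.1)).
  exact: pair1_measurable.
move=> r _; rewrite /Gam/= lee_fin mulrCA normrM (ger0_norm (discount_ge0 _ _)) mulrC.
rewrite [leRHS]ger0_norm ?mulr_ge0 ?discount_ge0//.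
by rewrite ler_wpM2r ?discount_ge0// normrM ler_pM.
Qed.

Let ThetaE z : (Theta z)%:E = \int[lambda]_r (Gam z.1 (z.2, r))%:E.
Proof. by rewrite /Theta /Rintegral fineK//; exact: integrable_fin_num. Qed.

Let Theta_neg s x : (s < 0)%R -> Theta (s, x) = 0%R.
Proof.
move=> s0; rewrite /Theta /Rintegral integral0_eq// => r _.
by rewrite /Gam/= U_neg// mul0r.
Qed.

Let Theta_bound z : (`|Theta z| <= M * M / alpha * discount alpha z.1)%R.
Proof.
rewrite -lee_fin -[leLHS]/(`|(Theta z)%:E|) ThetaE.
apply: (le_trans (le_abse_integral _ measurableT _)).
  exact: measurable_int (intGam1 z).
apply: (@le_trans _ _
  (\int[lambda]_r ((M * discount alpha z.1 * M) * discount alpha r)%:E)).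
  apply: ge0_le_integral => //.
  - by apply: measurableT_comp => //; exact: measurable_int (intGam1 z).
  - apply/measurable_EFinP; apply: measurable_funM => //.
    exact: measurable_discount.
  - move=> r _; rewrite /Gam/= lee_fin mulrCA normrM (ger0_norm (discount_ge0 _ _)).
    rewrite mulrC ler_wpM2r ?discount_ge0// normrM ler_pM//.
    by case: z => s x; exact: WM.
under eq_integral do rewrite EFinM.
rewrite integralZl//; last exact: integrable_discount.
rewrite integral_discount// -EFinM lee_fin.
by rewrite le_eqVlt; apply/orP; left; apply/eqP; ring.
Qed.

Let Theta_resolvent (s : R) x : (0 <= s)%R ->
  Theta (s, x) = (W (s, x) * space_time_resolvent P eta alpha W (s, x))%R.
Proof.
move=> s0.
have -> : Theta (s, x) =
  (\int[lambda]_r (U (s, x) * (discount alpha r * D ((s, r), x))))%R by [].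
rewrite RintegralZl//; last first.
  have := integrableZl measurableT M (integrable_discount alpha_gt0).
  apply: le_integrable => //.
    apply/measurable_EFinP; apply: measurable_funM.
      exact: measurable_discount.
    apply: (measurableT_comp mD); apply/measurable_fun_pair => //.
  move=> r _; rewrite /= lee_fin normrM (ger0_norm (discount_ge0 _ _)) mulrC.
  by rewrite [leRHS]ger0_norm ?mulr_ge0 ?discount_ge0// ler_wpM2r ?discount_ge0.
congr (_ * _)%R; first by rewrite /U /after0/= s0 mul1r.
rewrite /space_time_resolvent [RHS]Rintegral_mkcond; apply: eq_Rintegral => r _.
rewrite patchE mem_setE in_itv/= andbT /discount.
have [r0|r0] := leP 0%R r; last by rewrite !mul0r.
rewrite mul1r mulNr /D /space_time_semigroup unlock/=; congr (_ * fine _)%R.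
by apply: eq_integral => w _; rewrite xiE// /U /after0/= addr_ge0// mul1r.
Qed.

(** Unfolding the resolvent and exchanging integrals, the inner product is an
integral over s, r >= 0 of the expectation, under initial law nu, of W (s, x)
times the expectation from x of W (s + r, eta r); by the Markov property this is
a correlation of [W] along the stationary process. *)
Lemma resolvent_form (g : space_time R X -> R) :
  g \in Lfun ell_nu 2%:E ->
  g = space_time_resolvent P eta alpha W %[ae ell_nu] ->
  (L2_inner ell_nu W g)%:E =
  \int[plane]_z \int[m]_w (correlation w z)%:E.
Proof.
move=> /sub_Lfun_mfun /set_mem mg geq.
have intTheta : ell_nu.-integrable setT (EFin \o Theta).
  have I1 : H.-integrable setT
      (EFin \o (fun s => M * M / alpha * discount alpha s)%R).
    have := integrableZl measurableT (M * M / alpha)%R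
      (integrable_halfline_discount alpha_gt0).
    by apply: eq_integrable.
  apply: (dominated_integrable_prod mTheta I1
    (finite_measure_integrable_cst nu 1 measurableT)) => s x.
  by rewrite /= mulr1; exact: Theta_bound.
rewrite /L2_inner /Rintegral.
rewrite (_ : \int[ell_nu]_z _ = \int[ell_nu]_z (Theta z)%:E); last first.
  apply: ae_eq_integral => //.
  - by apply/measurable_EFinP; exact: measurable_funM.
  - exact/measurable_EFinP.
  apply: negligibleS (negligibleU geq (negative_times_null nu)) => -[s x] /=.
  move=> /not_implyP[_ WgT]; have [s0|s0] := ltP s 0%R; first by right.
  by left => gE; apply: WgT; rewrite Theta_resolvent// gE.
rewrite fineK; last exact: (integrable_fin_num measurableT intTheta).
rewrite -(integral12_prod_meas1 intTheta).
have integrable_corr := integrable_fubini_F integrable_correlation.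
rewrite -(integral12_prod_meas1 integrable_corr).
rewrite integral_halfline => [|s s0]; last first.
  by apply: integral0_eq => x _; rewrite /= Theta_neg.
apply: eq_integral => s _; rewrite /fubini_F/=.
under eq_integral do rewrite ThetaE/=.
rewrite (Fubini (intGam s)); apply: eq_integral => r _.
exact: markov_Gam.
Qed.

End resolvent_form.

(** * The second moment bound *)

Section second_moment_bound.
Context (R : realType) (X : ptopologicalType) d (Omega : measurableType d).
Variables (P : ukernel (borel X) Omega R) (F : R -> set (set Omega)).
Variables (eta : R -> Omega -> X) (nu : probability (borel X) R).
Hypotheses (borelX : borel_generated_by_continuous R X)
  (rp : right_process P F eta) (inv : invariant_state P eta nu).
Notation lambda := (@lebesgue_measure R).
Notation plane := (@lebesgue_plane R).
Notation mR := (measurableTypeR R).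
Notation m := (mixture P nu).
Notation ell_nu := (space_time_measure nu).
Notation path_space := (g_sigma_algebraType (path_events eta)).
Notation xi := (@halted_path R X d Omega eta).

Variables (beta c M : R) (V : space_time R X -> R).
Hypotheses (beta_gt0 : 0 < beta) (c_gt0 : 0 < c) (mV : measurable_fun setT V)
  (VM : forall (s : R) x, 0 <= s -> `|V (s, x)| <= M).

Let alpha := beta / (2 * c).
Let W := rescaled beta c V.

Let alpha_gt0 : 0 < alpha. Proof. by rewrite divr_gt0// mulr_gt0. Qed.

Lemma measurable_rescaled : measurable_fun setT W.
Proof.
apply: measurable_funM.
  apply: measurableT_comp => //; apply: measurableT_comp => //.
  by apply: measurable_funM => //; exact: measurable_funM.
apply: (measurableT_comp mV); apply/measurable_fun_pair => //.
exact: measurable_funM.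
Qed.

Lemma after0_rescaled_le z : `|after0 W z| <= M * discount alpha z.1.
Proof.
rewrite /after0 /discount; case: (leP 0 (z.1 : R)) => s0; last first.
  by rewrite !mul0r mulr0 normr0.
rewrite !mul1r normrM (ger0_norm (expR_ge0 _)) mulrC.
rewrite (_ : beta * z.1 / (2 * c) = alpha * z.1); last by rewrite /alpha; ring.
by rewrite ler_wpM2r ?expR_ge0// VM// divr_ge0// ltW.
Qed.

Let path_value (w : Omega) (s : mR) : R := (0 <= s)%R%:R * V (s, xi (c * s, w)).

Let mxi : measurable_fun setT xi.
Proof. exact: measurable_halted_path borelX (rp_right_continuous rp). Qed.

Let measurable_path_value :
  measurable_fun setT (fun y : Omega * mR => path_value y.1 y.2).
Proof.
apply: measurable_funM.
  by apply: measurable_natr_bool; exact: measurable_fun_ler.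
apply: (measurableT_comp mV); apply/measurable_fun_pair => //.
apply: (measurableT_comp mxi); apply/measurable_fun_pair.
  exact: measurable_funM.
exact: (measurableT_comp (measurable_path rp) measurable_fst).
Qed.

Let path_value_le w s : `|path_value w s| <= M.
Proof.
have M0 : 0 <= M by exact: le_trans (VM point (lexx 0)).
rewrite /path_value; case: (leP 0 s) => s0; last by rewrite mul0r normr0.
by rewrite mul1r VM.
Qed.

Let path_value_neg w (s : R) : s < 0 -> path_value w s = 0.
Proof. by move=> s0; rewrite /path_value leNgt s0 mul0r. Qed.

Let measurable_path_value_section w : measurable_fun setT (path_value w).
Proof.
have mp : measurable_fun setT (fun s : mR => (w, s)) by exact: pair1_measurable.
exact: (measurableT_comp measurable_path_value mp).
Qed.

(** Cutting off by indicators, rather than integrating over the varying interval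
[0, t], exhibits the integrand as jointly measurable in the path, t and s. *)
Definition primitive (w : Omega) (t : mR) : R :=
  \int[lambda]_s ((s <= t)%R%:R * path_value w s).

Lemma measurable_primitive :
  measurable_fun setT (fun y : Omega * mR => primitive y.1 y.2).
Proof.
apply: (@measurable_Rintegral_section _ _ _ _ _ lambda
  (fun y : (Omega * mR) * mR => (y.2 <= y.1.2)%R%:R * path_value y.1.1 y.2)).
apply: measurable_funM.
  apply: measurable_natr_bool; apply: measurable_fun_ler => //.
  exact: measurableT_comp.
have mp : measurable_fun setT (fun y : (Omega * mR) * mR => (y.1.1, y.2)).
  by apply/measurable_fun_pair => //; exact: measurableT_comp.
exact: (measurableT_comp measurable_path_value mp).
Qed.

Lemma primitiveE (w : Omega) (t : R) :
  \int[lambda]_(s in `[0, t]) V (s, eta (c * s) w) = primitive w t.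
Proof.
rewrite Rintegral_mkcond; apply: eq_Rintegral => s _.
rewrite patchE mem_setE in_itv/= /path_value.
have [s0|s0] := leP 0 s; last by rewrite mul0r mulr0.
rewrite mul1r /halted_path/= max_r; last by rewrite mulr_ge0// ltW.
by case: (s <= t); rewrite ?mul1r ?mul0r.
Qed.

Local Open Scope ereal_scope.

Let path_identity w :
  \int[lambda]_t (discount beta t * primitive w t ^+ 2)%:E =
  (2 / (beta * c ^+ 2))%:E *
    \int[plane]_z (correlation eta W alpha w z)%:E.
Proof.
rewrite (laplace_sqr_primitive (measurable_path_value_section w) (path_value_le w)
  (@path_value_neg w) beta_gt0).
rewrite (integral_max_triangle (measurable_path_value_section w) (path_value_le w)
  (@path_value_neg w) beta_gt0 c_gt0).
congr (_ * _); apply: eq_integral => -[s r] _; congr _%:E.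
have addE (u : R) : (expR (- (alpha * u)) * path_value w (u / c) =
    after0 W (u, xi (u, w)))%R.
  rewrite /path_value /after0 /W /rescaled/= pmulr_lge0 ?invr_gt0//.
  rewrite mulrCA; congr (_ * (expR (- _) * V (_, xi (_, w))))%R.
    by rewrite /alpha; ring.
  by rewrite mulrCA divff ?mulr1// gt_eqF.
by rewrite /correlation/= !addE.
Qed.

Let discounted_sqr (y : Omega * mR) : \bar R :=
  (discount beta y.2 * primitive y.1 y.2 ^+ 2)%:E.

Let discounted_sqr_ge0 y : 0 <= discounted_sqr y.
Proof. by rewrite lee_fin mulr_ge0 ?discount_ge0 ?sqr_ge0. Qed.

Let measurable_discounted_sqr : measurable_fun setT discounted_sqr.
Proof.
apply/measurable_EFinP; apply: measurable_funM.
  exact: (measurableT_comp (@measurable_discount R beta) measurable_snd).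
by apply: measurable_funX; exact: measurable_primitive.
Qed.

(** Integrate over the paths the deterministic identity satisfied by each of them,
and recognize the correlation integral of the resolvent. *)
Lemma laplace_second_moment (g : space_time R X -> R) :
  g \in Lfun ell_nu 2%:E ->
  g = space_time_resolvent P eta alpha W %[ae ell_nu] ->
  \int[lambda]_t \int[m]_w (discount beta t * primitive w t ^+ 2)%:E =
  (2 / (beta * c ^+ 2) * L2_inner ell_nu W g)%:E.
Proof.
move=> gL2 gE; rewrite EFinM.
rewrite (resolvent_form borelX rp inv measurable_rescaled alpha_gt0
  after0_rescaled_le gL2 gE).
have intC := integrable_correlation nu borelX rp measurable_rescaled alpha_gt0
  after0_rescaled_le.
rewrite (Fubini intC) -integralZl//; last exact: (integrable_fubini_G intC).
have <- := fubini_tonelli (m1 := m) (m2 := lambda) discounted_sqr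
  measurable_discounted_sqr discounted_sqr_ge0.
by apply: eq_integral => w _; exact: path_identity.
Qed.

(** On [0, T] the discount costs at most a factor exp (beta T). *)
Lemma integral_second_moment_le (T : R) :
  \int[lambda]_(t in `[0%R, T]) \int[m]_w (primitive w t ^+ 2)%:E <=
  (expR (beta * T))%:E *
    \int[lambda]_t \int[m]_w (discount beta t * primitive w t ^+ 2)%:E.
Proof.
have msqr : measurable_fun setT (fun y : Omega * mR => (primitive y.1 y.2 ^+ 2)%:E).
  by apply/measurable_EFinP; apply: measurable_funX; exact: measurable_primitive.
have sqr0 (y : Omega * mR) : 0 <= (primitive y.1 y.2 ^+ 2)%:E.
  by rewrite lee_fin sqr_ge0.
have mS := measurable_fun_fubini_tonelli_G (m1 := m) _ msqr sqr0.
have mA := measurable_fun_fubini_tonelli_G (m1 := m) _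
  measurable_discounted_sqr discounted_sqr_ge0.
have mpair t : measurable_fun setT (fun w : Omega => (w, t : mR)).
  exact: pair2_measurable.
have A0 t : 0 <= \int[m]_w discounted_sqr (w, t) by exact: integral_ge0.
apply: (@le_trans _ _ (\int[lambda]_(t in `[0%R, T])
    ((expR (beta * T))%:E * \int[m]_w discounted_sqr (w, t)))).
  apply: ge0_le_integral => //.
  - by move=> t _; apply: integral_ge0 => w _; rewrite lee_fin sqr_ge0.
  - exact: measurable_funTS.
  - by apply: measurable_funTS; exact: measurable_funeM.
  move=> t; rewrite /= in_itv/= => /andP[t0 tT].
  rewrite -ge0_integralZl//; last first.
    exact: (measurableT_comp measurable_discounted_sqr (mpair t)).
  apply: ge0_le_integral => //.
  - by move=> w _; rewrite lee_fin sqr_ge0.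
  - exact: (measurableT_comp msqr (mpair t)).
  - apply: measurable_funeM.
    exact: (measurableT_comp measurable_discounted_sqr (mpair t)).
  move=> w _; rewrite -EFinM lee_fin mulrA ler_peMl ?sqr_ge0//.
  rewrite /discount t0 mul1r -expRD -expR0 ler_expR subr_ge0.
  by rewrite ler_pM2l.
rewrite ge0_integralZl//; last exact: measurable_funTS.
by apply: lee_wpmul2l => //; exact: ge0_subset_integral.
Qed.

End second_moment_bound.

Theorem lemma2p1 (R : realType) (X : ptopologicalType)
    (d : measure_display) (Omega : measurableType d)
    (P : ukernel (borel X) Omega R) (F : R -> set (set Omega))
    (eta : R -> Omega -> X) (nu : probability (borel X) R)
    (G : R -> (space_time R X -> R) -> space_time R X -> R)
    (beta T c : R) :
  hausdorff_space X ->
  borel_generated_by_continuous R X ->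
  right_process P F eta ->
  invariant_state P eta nu ->
  space_time_L2_resolvent P eta nu G ->
  0 < beta -> 0 < T -> 0 < c ->
  forall V : space_time R X -> R,
    V \in Lfun (space_time_measure nu) 2%:E -> bounded_space_time V ->
    (\int[lebesgue_measure]_(t in `[0%R, T])
        'E_(mixture P nu)
          [(fun w => (\int[lebesgue_measure]_(s in `[0, t])
                       V (s, eta (c * s) w)) ^+ 2)%R]
     <= (2 * expR (beta * T) / (beta * c ^+ 2) *
         L2_inner (space_time_measure nu) (rescaled beta c V)
           (G (beta / (2 * c)) (rescaled beta c V)))%:E)%E.
Proof.
move=> _ borelX rp inv [scG G_resolvent] beta0 _ c0 V VL2 [M VM].
have alpha0 : 0 < beta / (2 * c) by rewrite divr_gt0// mulr_gt0.
have mV : measurable_fun setT V by move/sub_Lfun_mfun/set_mem: VL2.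
have mW := measurable_rescaled beta c mV.
have WM := after0_rescaled_le beta c0 VM.
have WL2 := discounted_Lfun2 nu alpha0 mW WM.
have M0 : 0 <= M by exact: le_trans (VM 0 point (lexx 0)).
have bW : bounded_space_time (rescaled beta c V).
  exists M => s x s0; have := WM (s, x); rewrite /after0/= s0 mul1r => /le_trans.
  by apply; rewrite ler_piMr// discount_le1// ltW.
have moment := laplace_second_moment borelX rp inv beta0 c0 mV VM
  (cr_Lfun scG alpha0 WL2) (G_resolvent _ _ alpha0 WL2 bW).
apply: (@le_trans _ _ (\int[lebesgue_measure]_(t in `[0%R, T])
    \int[mixture P nu]_w (primitive eta c V w t ^+ 2)%:E)%E).
  rewrite le_eqVlt; apply/orP; left; apply/eqP.
  apply: eq_integral => t _; rewrite unlock; apply: eq_integral => w _.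
  by congr ((_ ^+ 2)%:E); exact: primitiveE.
apply: (le_trans (integral_second_moment_le nu borelX rp c beta0 mV T)).
rewrite moment -EFinM lee_fin le_eqVlt; apply/orP; left; apply/eqP.
by field; rewrite !gt_eqF.
Qed.
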